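(* Assume (H1), (H2), (H3). Then for every $t>0$, $$\lim_{z\to\infty}\sup_{x>0}\Big|\frac{r(t,\infty,x)}{r(t,z,x)}-1\Big|=0.$$
   Context: Let $q\in C^1([0,\infty))$ and $X$ the diffusion $dX_t=dB_t-q(X_t)dt$ stopped at $0$. $\gamma(y)=2\int_0^yq$, $\mu(dx)=2e^{-\gamma(x)}dx$, $\mathcal Lu=\frac12u''-qu'$. (H1): $\int_0^\infty e^{\gamma(y)}\int_y^\infty e^{-\gamma(\xi)}d\xi\,dy<\infty$. (H2): $q(x)\to\infty$ and $q'(x)/q(x)^2\to0$. (H3): there exist $a>0$, $x_0\ge0$ with $\inf\{q(y):y\ge x\}\ge a\,q(x)$ for all $x\ge x_0$. Known spectral facts under (H1),(H2): the generator on $L^2(\mu)$ of $X$ killed at $0$ has discrete simple spectrum with eigenvalues $-\lambda_k$, $0<\lambda_1<\lambda_2<\cdots$, and $L^2(\mu)$-orthonormal eigenfunctions $\psi_k$ ($\mathcal L\psi_k=-\lambda_k\psi_k$, $\psi_k(0)=0$), each bounded with a finite limit $\psi_k(\infty)$ at infinity. For $y\in(0,\infty]$, $r(t,y,x)=\sum_{k\ge1}e^{-\lambda_kt}\psi_k(y)\psi_k(x)$; for finite $y$, $r(t,y,x)2e^{-\gamma(x)}dx=\mathbb P_y(X_t\in dx,\mathbb T_0>t)$, and $r(t,\infty,x)2e^{-\gamma(x)}dx$ is the corresponding density for the process started from infinity. *)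

(* Defs.v *)
From Stdlib Require Import Reals Lra ClassicalEpsilon.
Open Scope R_scope.

Definition IntR (g : R -> R) (a b I : R) : Prop :=
  exists pr : Riemann_integrable g a b, RiemannInt pr = I.

Definition ImproperInt (g : R -> R) (a L : R) : Prop :=
  (forall b, a <= b -> exists I, IntR g a b I) /\
  forall eps, 0 < eps -> exists B, forall b I, B <= b -> a <= b ->
    IntR g a b I -> Rabs (I - L) < eps.

Definition series_sum (u : nat -> R) : R :=
  epsilon (inhabits 0) (fun l => infinite_sum u l).

Definition C1_on_nonneg (q dq : R -> R) : Prop :=
  forall x, 0 <= x -> derivable_pt_lim q x (dq x) /\ continuity_pt dq x.

Definition gamma_of (q gamma : R -> R) : Prop :=
  forall y, 0 <= y -> IntR (fun s => 2 * q s) 0 y (gamma y).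

Definition mu_density (gamma : R -> R) (x : R) : R := 2 * exp (- gamma x).

Definition H1 (gamma : R -> R) : Prop :=
  exists G : R -> R,
    (forall y, 0 <= y -> ImproperInt (fun xi => exp (- gamma xi)) y (G y)) /\
    exists L, ImproperInt (fun y => exp (gamma y) * G y) 0 L.

Definition H2 (q dq : R -> R) : Prop :=
  (forall M, exists X, forall x, X <= x -> M <= q x) /\
  (forall eps, 0 < eps -> exists X, forall x, X <= x -> Rabs (dq x / (q x) ^ 2) < eps).

Definition H3 (q : R -> R) : Prop :=
  exists a x0, 0 < a /\ 0 <= x0 /\
    forall x y, x0 <= x -> x <= y -> a * q x <= q y.

(* (lam k, psi k)_{k} (index k = 0,1,... standing for 1,2,...) is the
   spectral data of the generator on L^2(mu) of X killed at 0:
   eigenvalues -lam k, 0 < lam_1 < lam_2 < ..., eigenfunctions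
   (1/2) psi'' - q psi' = - lam psi, psi(0) = 0, bounded, with limit
   psi_inf k at infinity, orthonormal and complete in L^2(mu). *)
Definition dirichlet_eigenbasis (q gamma : R -> R) (lam : nat -> R)
    (psi : nat -> R -> R) (psi_inf : nat -> R) : Prop :=
  0 < lam 0%nat /\
  (forall k, lam k < lam (S k)) /\
  (forall k, exists dpsi d2psi : R -> R, forall x, 0 < x ->
      derivable_pt_lim (psi k) x (dpsi x) /\
      derivable_pt_lim dpsi x (d2psi x) /\
      / 2 * d2psi x - q x * dpsi x = - lam k * psi k x) /\
  (forall k, psi k 0 = 0 /\
      forall eps, 0 < eps -> exists d, 0 < d /\
        forall x, 0 <= x < d -> Rabs (psi k x) < eps) /\
  (forall k, exists M, forall x, 0 <= x -> Rabs (psi k x) <= M) /\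
  (forall k eps, 0 < eps -> exists X, forall x, X <= x ->
      Rabs (psi k x - psi_inf k) < eps) /\
  (forall j k, ImproperInt (fun x => psi j x * psi k x * mu_density gamma x) 0
                 (if Nat.eq_dec j k then 1 else 0)) /\
  (* completeness: Parseval identity on the dense class of continuous
     functions compactly supported in (0, infty) *)
  (forall (f : R -> R) a b, 0 < a -> a < b -> continuity f ->
      (forall x, x < a \/ b < x -> f x = 0) ->
      exists (c : nat -> R) (nf : R),
        (forall k, IntR (fun x => f x * psi k x * mu_density gamma x) a b (c k)) /\
        IntR (fun x => f x ^ 2 * mu_density gamma x) a b nf /\
        infinite_sum (fun k => (c k) ^ 2) nf).

Definition r_fin (lam : nat -> R) (psi : nat -> R -> R) (t y x : R) : R :=
  series_sum (fun k => exp (- lam k * t) * psi k y * psi k x).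

Definition r_inf (lam : nat -> R) (psi : nat -> R -> R) (psi_inf : nat -> R)
    (t x : R) : R :=
  series_sum (fun k => exp (- lam k * t) * psi_inf k * psi k x).

(* Main.v *)
Require Import Defs.
From Stdlib Require Import Reals Lra Lia Psatz Arith Compare_dec ClassicalEpsilon.
From Coquelicot Require Import Coquelicot.
Open Scope R_scope.

(** Write [m = exp (- gamma)], [p = exp gamma], [G x = int_x^oo m], [Lam x = int_0^x p] and [S x = int_0^x p G], so
    that [L S = - 1/2], [L Lam = 0], and (H1) says that [S] is bounded. An eigenfunction bounded by [M] satisfies
    [|psi'| <= 2 lam M S'], hence [|r(t,oo,x) - r(t,z,x)| <= C S(x) (S(oo) - S(z))] as soon as
    [sum exp(- lam_k t) (1 + lam_k)^2 |psi_k|_oo^2] converges, and everything reduces to this convergence and to the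
    lower bound [r(t,oo,x) >= c S(x)].
    - Convergence: the Dirichlet form gives [sum psi_k^2 / lam_k <= Lam], thus [lam_k >= c k]; beyond the point where
      [q^2] is of order [lam], [psi_k] is controlled by the supersolution [exp (4 lam S)], and by (H2), (H3) the total
      loss is [|psi_k|_oo^2 = exp (o(lam_k))].
    - Lower bound: a maximum principle for the implicit Euler scheme [u_{n-1} = u_n - h L u_n], applied to finite
      spectral sums, avoids all termwise differentiation. With the completeness of the eigenfunctions it yields
      [r(t,oo,x) >= 0]. Near [x = oo] the kernel is close to [sum exp(- lam_k t) psi_k(oo)^2 > 0], and a sliding
      exponential subsolution carries this positivity down to [x = 0]. *)

(** * Continuous functions, integrals and derivatives *)

(** Both [r(t,oo,x)] and its distance to [r(t,z,x)] vanish as [x] tends to 0, so a ratio that is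
    uniform in [x] requires measuring both against one function. This function is [S], half the mean
    hitting time of 0: each eigenfunction is Lipschitz with respect to it, at 0 as well as at
    infinity. The obstacle is the lower bound. Only spectral data are given, so positivity of the
    kernel has to be derived, and partial sums of the series have no sign. Each positivity statement
    therefore carries an error that the comparison tolerates: [eps (1 + Lam)], which is stationary
    under the evolution, or the geometric remainder of the series. Parseval controls test functions
    only in L2; one resolvent step is inserted because it turns an L2 error into a pointwise one.
    The time [t] is split into halves: the first yields a nonnegative kernel, the second is the time
    during which the comparison from these nonnegative data spreads the positivity at infinity down
    to 0. *)

Definition cont (f : R -> R) : Prop := forall x, continuous f x.

Lemma cont_const c : cont (fun _ => c).
Proof. intros x; apply continuous_const. Qed.
Lemma cont_id : cont (fun x => x).
Proof. intros x; apply continuous_id. Qed.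
Lemma cont_plus f g : cont f -> cont g -> cont (fun x => f x + g x).
Proof. intros Hf Hg x; apply @continuous_plus; auto. Qed.
Lemma cont_minus f g : cont f -> cont g -> cont (fun x => f x - g x).
Proof. intros Hf Hg x; apply @continuous_minus; auto. Qed.
Lemma cont_opp f : cont f -> cont (fun x => - f x).
Proof. intros Hf x; apply @continuous_opp; auto. Qed.
Lemma cont_mult f g : cont f -> cont g -> cont (fun x => f x * g x).
Proof. intros Hf Hg x; apply @continuous_mult; auto. Qed.
Lemma cont_pow f n : cont f -> cont (fun x => f x ^ n).
Proof.
  intros Hf; induction n as [|n IH]; simpl.
  - apply cont_const.
  - now apply cont_mult.
Qed.
Lemma cont_comp f g : cont f -> cont g -> cont (fun x => f (g x)).
Proof. intros Hf Hg x; apply (continuous_comp g f); auto. Qed.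
Lemma cont_exp f : cont f -> cont (fun x => exp (f x)).
Proof. intros Hf; apply (cont_comp exp); auto; intros x; apply continuous_exp. Qed.
Lemma cont_abs f : cont f -> cont (fun x => Rabs (f x)).
Proof. intros Hf; apply (cont_comp Rabs); auto; intros x; apply continuous_Rabs. Qed.
Lemma cont_ext f g : (forall x, f x = g x) -> cont f -> cont g.
Proof. intros H Hf x; apply continuous_ext with f; auto. Qed.
Lemma cont_derive f df : (forall x, is_derive f x (df x)) -> cont f.
Proof. intros H x; apply (@ex_derive_continuous R_AbsRing); exists (df x); auto. Qed.
Lemma cont_sum (u : nat -> R -> R) N :
  (forall k, cont (u k)) -> cont (fun x => sum_f_R0 (fun k => u k x) N).
Proof.
  intros H; induction N as [|N IH]; simpl; [apply H|].
  apply cont_plus; auto.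
Qed.

Create HintDb cont_db discriminated.

Ltac ctac :=
  cbv beta;
  lazymatch goal with
  | |- cont (fun _ => ?c) => apply (cont_const c)
  | |- cont (fun x => x) => apply cont_id
  | |- cont (fun x => @?f x + @?g x) => apply (cont_plus f g); ctac
  | |- cont (fun x => @?f x - @?g x) => apply (cont_minus f g); ctac
  | |- cont (fun x => @?f x * @?g x) => apply (cont_mult f g); ctac
  | |- cont (fun x => - @?f x) => apply (cont_opp f); ctac
  | |- cont (fun x => @?f x ^ ?n) => apply (cont_pow f n); ctac
  | |- cont (fun x => exp (@?f x)) => apply (cont_exp f); ctac
  | |- cont (fun x => Rabs (@?f x)) => apply (cont_abs f); ctac
  | |- cont (fun x => sum_f_R0 (fun k => @?u x k) ?N) =>
      apply (cont_sum (fun k x => u x k) N); intros; ctac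
  | |- cont (fun x => ?f x) => change (cont f); solve [auto with cont_db]
  | |- _ => solve [auto with cont_db]
  end.

Lemma cont_Rmax0 : cont (fun x => Rmax 0 x).
Proof.
  apply (cont_ext (fun x => (x + Rabs x) * / 2)); [|ctac].
  intros x; unfold Rmax; destruct (Rle_dec 0 x); unfold Rabs; destruct (Rcase_abs x); lra.
Qed.

Lemma ex_RInt_cont f a b : cont f -> ex_RInt f a b.
Proof. intros H; apply @ex_RInt_continuous; intros; apply H. Qed.

Lemma is_derive_RInt_cont f a x : cont f -> is_derive (fun y => RInt f a y) x (f x).
Proof.
  intros H; apply @is_derive_RInt with a; [|apply H].
  exists posreal_one; intros y _; apply @RInt_correct, ex_RInt_cont, H.
Qed.

Lemma cont_RInt f a : cont f -> cont (fun x => RInt f a x).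
Proof. intros H; apply cont_derive with f; intros; now apply is_derive_RInt_cont. Qed.

Lemma is_derive_continuity_pt f x l : is_derive f x l -> continuity_pt f x.
Proof.
  intros H; apply continuity_pt_filterlim.
  apply (@ex_derive_continuous R_AbsRing); now exists l.
Qed.

Lemma derive_nonneg_le f df a b : a <= b ->
  (forall x, a <= x <= b -> is_derive f x (df x)) ->
  (forall x, a <= x <= b -> 0 <= df x) -> f a <= f b.
Proof.
  intros Hab Hd Hp.
  destruct (MVT_gen f a b df) as [c [Hc Heq]].
  - intros x; rewrite Rmin_left, Rmax_right by lra; intros; apply Hd; lra.
  - intros x; rewrite Rmin_left, Rmax_right by lra; intros.
    apply is_derive_continuity_pt with (df x), Hd; lra.
  - rewrite Rmin_left, Rmax_right in Hc by lra.
    specialize (Hp c Hc); nra.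
Qed.

Lemma RInt_ftc F f a b : a <= b -> cont f ->
  (forall x, a <= x <= b -> is_derive F x (f x)) -> RInt f a b = F b - F a.
Proof.
  intros Hab Hf HF; apply is_RInt_unique.
  apply (@is_RInt_derive R_CompleteNormedModule); intros x; rewrite Rmin_left, Rmax_right by lra; auto.
Qed.

Lemma RInt_point0 (f : R -> R) a : RInt f a a = 0.
Proof. apply (@RInt_point R_CompleteNormedModule). Qed.

Lemma RInt_le_cont f g a b : a <= b -> cont f -> cont g ->
  (forall x, a < x < b -> f x <= g x) -> RInt f a b <= RInt g a b.
Proof. intros; apply RInt_le; auto using ex_RInt_cont. Qed.

Lemma RInt_nonneg f a b : a <= b -> cont f -> (forall x, a < x < b -> 0 <= f x) ->
  0 <= RInt f a b.
Proof. intros; apply RInt_ge_0; auto using ex_RInt_cont. Qed.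

Lemma RInt_plus_cont f g a b : cont f -> cont g ->
  RInt (fun x => f x + g x) a b = RInt f a b + RInt g a b.
Proof. intros; apply (@RInt_plus R_CompleteNormedModule); auto using ex_RInt_cont. Qed.

Lemma RInt_scal_cont f c a b : cont f ->
  RInt (fun x => c * f x) a b = c * RInt f a b.
Proof. intros; apply (@RInt_scal R_CompleteNormedModule); auto using ex_RInt_cont. Qed.

Lemma RInt_Chasles_cont f a b c : cont f -> RInt f a b + RInt f b c = RInt f a c.
Proof. intros; apply (@RInt_Chasles R_CompleteNormedModule); auto using ex_RInt_cont. Qed.

Lemma RInt_ext_all (f g : R -> R) a b : (forall x, f x = g x) -> RInt f a b = RInt g a b.
Proof. intros; apply RInt_ext; auto. Qed.

Lemma RInt_nonneg_mono f a b c : a <= b <= c -> cont f -> (forall x, a <= x -> 0 <= f x) ->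
  RInt f a b <= RInt f a c.
Proof.
  intros H Hf Hp; rewrite <- (RInt_Chasles_cont f a b c) by auto.
  assert (0 <= RInt f b c) by (apply RInt_nonneg; [lra|auto|intros; apply Hp; lra]).
  lra.
Qed.

Lemma RInt_sum (u : nat -> R -> R) N a b : (forall k, cont (u k)) ->
  RInt (fun x => sum_f_R0 (fun k => u k x) N) a b = sum_f_R0 (fun k => RInt (u k) a b) N.
Proof.
  intros H; induction N as [|N IH]; simpl; [reflexivity|].
  rewrite RInt_plus_cont; [now rewrite IH| |apply H].
  now apply cont_sum.
Qed.

Lemma is_derive_sum (u du : nat -> R -> R) N x :
  (forall k, is_derive (u k) x (du k x)) ->
  is_derive (fun y => sum_f_R0 (fun k => u k y) N) x (sum_f_R0 (fun k => du k x) N).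
Proof.
  intros H; induction N as [|N IH]; simpl; [apply H|].
  apply (@is_derive_plus R_AbsRing R_NormedModule); auto.
Qed.

(** The minimiser [- B / C] is tested or, when [C = 0], a point where the remaining affine function
    equals -1. In the Cauchy-Schwarz inequality the quadratic is the integral of [(f + s g)^2 w]. *)
Lemma quad_discr A B C : 0 <= C -> (forall s, 0 <= A + 2 * s * B + s ^ 2 * C) -> B ^ 2 <= A * C.
Proof.
  intros HC H.
  destruct (Req_dec C 0) as [->|HC0].
  - destruct (Req_dec B 0) as [->|HB]; [lra|].
    specialize (H (- (A + 1) / (2 * B))).
    replace (A + 2 * (- (A + 1) / (2 * B)) * B + (- (A + 1) / (2 * B)) ^ 2 * 0) with (-1) in H
      by (field; auto); lra.
  - specialize (H (- B / C)).
    replace (A + 2 * (- B / C) * B + (- B / C) ^ 2 * C) with ((A * C - B ^ 2) * / C) in H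
      by (field; auto).
    assert (0 < / C) by (apply Rinv_0_lt_compat; lra); nra.
Qed.

Lemma RInt_cauchy_schwarz f g w a b : a <= b -> cont f -> cont g -> cont w ->
  (forall x, a < x < b -> 0 <= w x) ->
  (RInt (fun x => f x * g x * w x) a b) ^ 2 <=
  RInt (fun x => f x ^ 2 * w x) a b * RInt (fun x => g x ^ 2 * w x) a b.
Proof.
  intros Hab Hf Hg Hw Hp; apply quad_discr.
  - apply RInt_nonneg; auto; [ctac|intros; apply Rmult_le_pos; [apply pow2_ge_0|auto]].
  - intros s.
    rewrite <- (RInt_scal_cont (fun x => f x * g x * w x)) by ctac.
    rewrite <- (RInt_scal_cont (fun x => g x ^ 2 * w x)) by ctac.
    rewrite <- RInt_plus_cont by ctac.
    rewrite <- RInt_plus_cont by ctac.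
    apply RInt_nonneg; auto; [ctac|].
    intros x Hx; specialize (Hp x Hx).
    replace (_ + _) with ((f x + s * g x) ^ 2 * w x) by ring.
    apply Rmult_le_pos; [apply pow2_ge_0|auto].
Qed.

(** If [p = exp gamma] and [v' = p j], then [L v = p j' / 2], so the inequality below reads [v - h L v >= 0]. *)
Lemma resolvent_max_principle (p v j dj : R -> R) h X : 0 < X -> 0 < h ->
  (forall x, 0 < p x) ->
  (forall x, 0 <= x <= X -> is_derive v x (p x * j x)) ->
  (forall x, 0 <= x <= X -> is_derive j x (dj x)) ->
  (forall x, 0 < x < X -> 0 <= v x - h / 2 * p x * dj x) ->
  0 <= v 0 -> 0 <= v X -> forall x, 0 <= x <= X -> 0 <= v x.
Proof.
  intros HX Hh Hp Hv Hj Hm H0 HX0 x Hx.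
  destruct (continuity_ab_min v 0 X) as [y [Hmin Hy]]; [lra| |].
  { intros c Hc; eapply is_derive_continuity_pt, Hv; auto. }
  apply Rle_trans with (v y); [|auto].
  destruct (Rle_lt_dec 0 (v y)) as [|Hneg]; auto.
  assert (Hy' : 0 < y < X).
  { split; apply Rnot_le_lt; intros Hle.
    - assert (y = 0) by lra; subst; lra.
    - assert (y = X) by lra; subst; lra. }
  assert (Hdy : p y * j y = 0).
  { assert (D : derivable_pt_lim v y (p y * j y)) by (apply is_derive_Reals, Hv; lra).
    rewrite <- (deriv_minimum v 0 X y (exist _ _ D)); auto; try (apply Hy').
    intros; apply Hmin; lra. }
  assert (Hj0 : j y = 0).
  { specialize (Hp y); destruct (Rmult_integral _ _ Hdy); lra. }
  (* Second-order condition at a minimum, read on the flux: with [j y = 0], a negative [dj y] makes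
     [j] negative just to the right of [y], and [v] falls below its minimum. *)
  assert (Hdj : 0 <= dj y).
  { apply Rnot_lt_le; intros Hlt.
    assert (D : derivable_pt_lim j y (dj y)) by (apply is_derive_Reals, Hj; lra).
    destruct (D (- dj y / 2)) as [d Hd]; [lra|].
    set (d' := Rmin (d / 2) ((X - y) / 2)).
    assert (Hd' : 0 < d' /\ d' <= d / 2 /\ d' <= (X - y) / 2).
    { pose proof (cond_pos d); unfold d'; repeat split.
      - apply Rmin_pos; lra.
      - apply Rmin_l.
      - apply Rmin_r. }
    assert (Hjn : forall s, 0 < s <= d' -> j (y + s) < 0).
    { intros s Hs; specialize (Hd s ltac:(lra)).
      pose proof (cond_pos d); rewrite (Rabs_pos_eq s) in Hd by lra.
      specialize (Hd ltac:(lra)); rewrite Hj0, Rminus_0_r in Hd.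
      apply Rabs_def2 in Hd.
      assert (j (y + s) / s < 0) by lra.
      replace (j (y + s)) with (j (y + s) / s * s) by (field; lra); nra. }
    (* As [j] vanishes at [y] itself, the first half only gives a weak decrease; the strict one
       comes from the mean value theorem on the second half. *)
    assert (H1 : - v y <= - v (y + d' / 2)).
    { apply (derive_nonneg_le (fun x => - v x) (fun x => - (p x * j x))); [lra| |].
      - intros z Hz; apply (@is_derive_opp R_AbsRing R_NormedModule), Hv; lra.
      - intros z Hz; specialize (Hp z).
        destruct (Req_dec z y) as [->|Hzy]; [lra|].
        specialize (Hjn (z - y) ltac:(lra)).
        replace (y + (z - y)) with z in Hjn by ring; nra. }
    destruct (MVT_gen v (y + d' / 2) (y + d') (fun x => p x * j x)) as [c [Hc Heq]].
    - intros z; rewrite Rmin_left, Rmax_right by lra; intros; apply Hv; lra.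
    - intros z; rewrite Rmin_left, Rmax_right by lra; intros.
      eapply is_derive_continuity_pt, Hv; lra.
    - rewrite Rmin_left, Rmax_right in Hc by lra.
      specialize (Hjn (c - y) ltac:(lra)).
      replace (y + (c - y)) with c in Hjn by ring.
      specialize (Hp c).
      assert (v y <= v (y + d')) by (apply Hmin; lra).
      assert (p c * j c < 0) by (rewrite <- (Rmult_0_r (p c)); apply Rmult_lt_compat_l; lra).
      assert (p c * j c * (y + d' - (y + d' / 2)) < 0) by (rewrite <- (Rmult_0_l (y + d' - (y + d' / 2))); apply Rmult_lt_compat_r; lra).
      lra. }
  specialize (Hm y Hy').
  assert (0 <= h / 2 * p y * dj y) by (specialize (Hp y); apply Rmult_le_pos; [apply Rmult_le_pos|]; lra).
  lra.
Qed.

Lemma exp_le x y : x <= y -> exp x <= exp y.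
Proof. intros [H| ->]; [left; now apply exp_increasing|right; reflexivity]. Qed.

Lemma exp_pow z n : exp z ^ n = exp (INR n * z).
Proof.
  induction n as [|n IH].
  - simpl; rewrite Rmult_0_l, exp_0; reflexivity.
  - rewrite S_INR; simpl; rewrite IH, <- exp_plus; f_equal; ring.
Qed.

Ltac derive_subst E :=
  match type of E with is_derive ?f ?y ?l =>
    repeat match goal with |- context [Derive ?g ?z] =>
      replace (Derive g z) with l by (symmetry; exact (is_derive_unique f y l E)) end end.

(** * Scale, speed and bounded eigenfunctions *)

Definition scale (gamma : R -> R) (x : R) : R := RInt (fun y => exp (gamma y)) 0 x.

(** [G0] stands for the mass of [exp (- gamma)] on the half-line. Subtracting a proper integral from
    it gives a function differentiable on the whole line. *)
Definition tail (gamma : R -> R) (G0 x : R) : R := G0 - RInt (fun y => exp (- gamma y)) 0 x.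

(** Half the mean hitting time of 0 from [x]; its boundedness says that infinity is an entrance
    boundary. *)
Definition entrance (gamma : R -> R) (G0 x : R) : R :=
  RInt (fun y => exp (gamma y) * tail gamma G0 y) 0 x.

(** (H1) and the growth of [q] in usable form, with [L] the limit of [entrance] at infinity. [q] and
    [gamma] live on the whole line so that derivatives at 0 are two-sided; the bounds concern the
    half-line. *)
Record diffusion (q gamma : R -> R) (G0 L : R) : Prop := {
  drift_cont : cont q;
  gamma_derive : forall x, is_derive gamma x (2 * q x);
  drift_infty : forall M, exists X, 0 <= X /\ forall x, X <= x -> M <= q x;
  tail_nonneg : forall x, 0 <= x -> 0 <= tail gamma G0 x;
  tail_vanish : forall eps, 0 < eps -> exists X, 0 <= X /\ forall x, X <= x -> tail gamma G0 x < eps;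
  entrance_le : forall x, 0 <= x -> entrance gamma G0 x <= L;
  entrance_lim : forall eps, 0 < eps ->
    exists X, 0 <= X /\ forall x, X <= x -> L - entrance gamma G0 x < eps
}.

(** The second-order equation as a first-order system for [psi] and its flux
    [J = exp (- gamma) psi']. The flux equation is asked only for [x >= 0], where the extended
    eigenfunction agrees with the original one. *)
Record eigenfn (gamma : R -> R) (lam : R) (psi J : R -> R) : Prop := {
  eig_pos : 0 < lam;
  eig_cont : cont psi;
  flux_cont : cont J;
  eig_derive : forall x, is_derive psi x (exp (gamma x) * J x);
  flux_derive : forall x, 0 <= x -> is_derive J x (- 2 * lam * exp (- gamma x) * psi x);
  eig_zero : psi 0 = 0;
  eig_bounded : exists M, forall x, 0 <= x -> Rabs (psi x) <= M
}.

Section Diffusion.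

Variables (q gamma : R -> R) (G0 L : R).
Hypothesis Hd : diffusion q gamma G0 L.

Local Notation p x := (exp (gamma x)).
Local Notation m x := (exp (- gamma x)).
Local Notation Lam := (scale gamma).
Local Notation G := (tail gamma G0).
Local Notation S := (entrance gamma G0).

Lemma gamma_cont : cont gamma.
Proof. apply cont_derive with (fun x => 2 * q x), Hd. Qed.
Hint Resolve gamma_cont : cont_db.

Lemma exp_gamma_mult x : p x * m x = 1.
Proof. rewrite <- exp_plus, Rplus_opp_r; apply exp_0. Qed.

Lemma scale_derive x : is_derive Lam x (p x).
Proof. apply (is_derive_RInt_cont (fun y => p y)); ctac. Qed.

Lemma scale_cont : cont Lam.
Proof. apply cont_derive with (fun x => p x), scale_derive. Qed.

Lemma tail_derive x : is_derive G x (- m x).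
Proof.
  unfold tail; evar_last.
  - apply (@is_derive_minus R_AbsRing R_NormedModule); [apply @is_derive_const|].
    apply (is_derive_RInt_cont (fun y => m y)); ctac.
  - unfold minus, plus, opp, zero; simpl; ring.
Qed.

Lemma tail_cont : cont G.
Proof. apply cont_derive with (fun x => - m x), tail_derive. Qed.
Hint Resolve scale_cont tail_cont : cont_db.

Lemma entrance_derive x : is_derive S x (p x * G x).
Proof. apply (is_derive_RInt_cont (fun y => p y * G y)); ctac. Qed.

Lemma entrance_cont : cont S.
Proof. apply cont_derive with (fun x => p x * G x), entrance_derive. Qed.
Hint Resolve entrance_cont : cont_db.

Lemma scale_0 : Lam 0 = 0.
Proof. apply RInt_point0. Qed.

Lemma entrance_0 : S 0 = 0.
Proof. apply RInt_point0. Qed.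

Lemma scale_mono x y : x <= y -> Lam x <= Lam y.
Proof.
  intros H; apply derive_nonneg_le with (fun x => p x); auto; intros.
  - apply scale_derive.
  - left; apply exp_pos.
Qed.

Lemma scale_nonneg x : 0 <= x -> 0 <= Lam x.
Proof. intros H; rewrite <- scale_0; now apply scale_mono. Qed.

Lemma entrance_mono x y : 0 <= x <= y -> S x <= S y.
Proof.
  intros H; apply derive_nonneg_le with (fun x => p x * G x); [lra| |]; intros.
  - apply entrance_derive.
  - apply Rmult_le_pos; [left; apply exp_pos|apply Hd; lra].
Qed.

Lemma entrance_nonneg x : 0 <= x -> 0 <= S x.
Proof. intros H; rewrite <- entrance_0; apply entrance_mono; lra. Qed.

Lemma entrance_limit_nonneg : 0 <= L.
Proof. rewrite <- entrance_0; apply Hd; lra. Qed.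

(** Eventually [q >= 0], so [exp gamma] is nondecreasing and [Lam] grows at least linearly. This is
    the barrier that excludes unbounded behaviour at infinity. *)
Lemma scale_unbounded M : exists X, 0 <= X /\ forall x, X <= x -> M <= Lam x.
Proof.
  destruct (drift_infty _ _ _ _ Hd 0) as [X0 [HX0 Hq]].
  assert (Hpx : forall x, X0 <= x -> Lam X0 + p X0 * (x - X0) <= Lam x).
  { intros x Hx.
    assert (Hg : forall y, X0 <= y -> p X0 <= p y).
    { intros y Hy; apply exp_le.
      apply derive_nonneg_le with (fun x => 2 * q x); auto; intros z Hz.
      - apply Hd.
      - specialize (Hq z ltac:(lra)); lra. }
    assert (H : Lam X0 - p X0 * X0 <= Lam x - p X0 * x).
    { apply (derive_nonneg_le (fun x => Lam x - p X0 * x) (fun x => p x - p X0)); auto; intros z Hz.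
      - evar_last.
        + apply (@is_derive_minus R_AbsRing R_NormedModule); [apply scale_derive|].
          apply @is_derive_scal, @is_derive_id.
        + unfold minus, plus, opp, one; simpl; ring.
      - specialize (Hg z ltac:(lra)); lra. }
    lra. }
  pose proof (exp_pos (gamma X0)) as Hp.
  exists (X0 + Rmax 0 M / p X0); split.
  - assert (0 <= Rmax 0 M / p X0) by (apply Rdiv_le_0_compat; auto; apply Rmax_l); lra.
  - intros x Hx.
    assert (0 <= Rmax 0 M / p X0) by (apply Rdiv_le_0_compat; auto; apply Rmax_l).
    specialize (Hpx x ltac:(lra)).
    assert (p X0 * (Rmax 0 M / p X0) <= p X0 * (x - X0)) by (apply Rmult_le_compat_l; lra).
    replace (p X0 * (Rmax 0 M / p X0)) with (Rmax 0 M) in H0 by (field; lra).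
    pose proof (Rmax_r 0 M); pose proof (scale_nonneg X0 HX0); lra.
Qed.

Lemma eigenfn_opp lam psi J : eigenfn gamma lam psi J ->
  eigenfn gamma lam (fun x => - psi x) (fun x => - J x).
Proof.
  intros [H1 H2 H3 H4 H5 H6 [M HM]]; split; auto.
  - ctac.
  - ctac.
  - intros x; replace (p x * - J x) with (- (p x * J x)) by ring.
    now apply (@is_derive_opp R_AbsRing R_NormedModule).
  - intros x Hx.
    replace (- 2 * lam * m x * - psi x) with (- (- 2 * lam * m x * psi x)) by ring.
    now apply (@is_derive_opp R_AbsRing R_NormedModule), H5.
  - rewrite H6; ring.
  - exists M; intros x Hx; rewrite Rabs_Ropp; auto.
Qed.

(** [J - 2 lam M G] has derivative [2 lam m (M - psi) >= 0]. Were it positive at [x], [J] would stay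
    above a constant [c > 0] and [psi] would grow like [c Lam], against its bound. *)
Lemma flux_upper_bound lam psi J x0 M : eigenfn gamma lam psi J -> 0 <= x0 ->
  (forall x, x0 <= x -> Rabs (psi x) <= M) ->
  forall x, x0 <= x -> J x <= 2 * lam * M * G x.
Proof.
  intros He Hx0 HM x Hx.
  apply Rnot_lt_le; intros Hlt.
  set (c := J x - 2 * lam * M * G x).
  assert (Hc : 0 < c) by (unfold c; lra).
  pose proof (eig_pos _ _ _ _ He) as Hlam.
  assert (HM0 : 0 <= M) by (apply Rle_trans with (2 := HM x0 (Rle_refl _)), Rabs_pos).
  assert (HJ : forall y, x <= y -> c <= J y).
  { intros y Hy.
    assert (H : J x - 2 * lam * M * G x <= J y - 2 * lam * M * G y).
    { apply (derive_nonneg_le (fun z => J z - 2 * lam * M * G z)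
        (fun z => - 2 * lam * m z * psi z - 2 * lam * M * - m z)); auto; intros z Hz.
      - apply (@is_derive_minus R_AbsRing R_NormedModule); [apply He; lra|].
        apply @is_derive_scal, tail_derive.
      - specialize (HM z ltac:(lra)).
        assert (Hz1 : psi z <= M) by (apply Rle_trans with (2 := HM), Rle_abs).
        pose proof (exp_pos (- gamma z)) as Hz2.
        replace (_ - _) with (2 * lam * m z * (M - psi z)) by ring.
        repeat apply Rmult_le_pos; lra. }
    pose proof (tail_nonneg _ _ _ _ Hd y ltac:(lra)).
    assert (0 <= 2 * lam * M * G y) by (repeat apply Rmult_le_pos; lra).
    unfold c; lra. }
  assert (Hpsi : forall y, x <= y -> c * (Lam y - Lam x) <= psi y - psi x).
  { intros y Hy.
    assert (H : psi x - c * Lam x <= psi y - c * Lam y).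
    { apply (derive_nonneg_le (fun z => psi z - c * Lam z) (fun z => p z * J z - c * p z)); auto; intros z Hz.
      - apply (@is_derive_minus R_AbsRing R_NormedModule); [apply He|].
        apply @is_derive_scal, scale_derive.
      - specialize (HJ z ltac:(lra)); pose proof (exp_pos (gamma z)).
        replace (_ - _) with (p z * (J z - c)) by ring.
        apply Rmult_le_pos; lra. }
    lra. }
  (* Up to this height [psi] would rise by [2 M + 1], more than the oscillation [2 M] it is
     allowed. *)
  destruct (scale_unbounded (Lam x + (2 * M + 1) / c)) as [X [HX HLam]].
  set (y := Rmax X x).
  assert (Hy : x <= y) by apply Rmax_r.
  specialize (HLam y (Rmax_l _ _)); specialize (Hpsi y Hy).
  assert (c * ((2 * M + 1) / c) <= c * (Lam y - Lam x)) by (apply Rmult_le_compat_l; lra).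
  replace (c * ((2 * M + 1) / c)) with (2 * M + 1) in H by (field; lra).
  pose proof (HM x Hx) as B1; pose proof (HM y ltac:(lra)) as B2.
  apply Rabs_le_between in B1; apply Rabs_le_between in B2; lra.
Qed.

Lemma flux_bound lam psi J x0 M : eigenfn gamma lam psi J -> 0 <= x0 ->
  (forall x, x0 <= x -> Rabs (psi x) <= M) ->
  forall x, x0 <= x -> Rabs (J x) <= 2 * lam * M * G x.
Proof.
  intros He Hx0 HM x Hx; apply Rabs_le; split.
  - enough (- J x <= 2 * lam * M * G x) by lra.
    apply (flux_upper_bound lam (fun x => - psi x) (fun x => - J x) x0); auto.
    + now apply eigenfn_opp.
    + intros y Hy; rewrite Rabs_Ropp; auto.
  - now apply (flux_upper_bound lam psi J x0).
Qed.

(** Since [psi' = p J] and [S' = p G], the flux bound makes both [2 lam M S + psi] and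
    [2 lam M S - psi] nondecreasing. *)
Lemma eigenfn_increment lam psi J x0 M : eigenfn gamma lam psi J -> 0 <= x0 ->
  (forall x, x0 <= x -> Rabs (psi x) <= M) ->
  forall x y, x0 <= x <= y -> Rabs (psi y - psi x) <= 2 * lam * M * (S y - S x).
Proof.
  intros He Hx0 HM x y Hxy.
  assert (HJ := flux_bound lam psi J x0 M He Hx0 HM).
  set (c := 2 * lam * M) in *.
  apply Rabs_le; split.
  - assert (H : psi x + c * S x <= psi y + c * S y); [|lra].
    apply (derive_nonneg_le (fun z => psi z + c * S z) (fun z => p z * J z + c * (p z * G z))); [lra| |]; intros z Hz.
    + apply (@is_derive_plus R_AbsRing R_NormedModule); [apply He|].
      apply @is_derive_scal, entrance_derive.
    + specialize (HJ z ltac:(lra)); apply Rabs_le_between in HJ.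
      replace (_ + _) with (p z * (J z + c * G z)) by ring.
      apply Rmult_le_pos; [left; apply exp_pos|lra].
  - assert (H : - psi x + c * S x <= - psi y + c * S y); [|lra].
    apply (derive_nonneg_le (fun z => - psi z + c * S z) (fun z => - (p z * J z) + c * (p z * G z))); [lra| |]; intros z Hz.
    + apply (@is_derive_plus R_AbsRing R_NormedModule).
      * apply (@is_derive_opp R_AbsRing R_NormedModule), He.
      * apply @is_derive_scal, entrance_derive.
    + specialize (HJ z ltac:(lra)); apply Rabs_le_between in HJ.
      replace (_ + _) with (p z * (- J z + c * G z)) by ring.
      apply Rmult_le_pos; [left; apply exp_pos|lra].
Qed.

(** The supersolution [h = exp (c S)] with [c = 4 lam'] satisfies [L h <= - lam' h] where [8 lam' S'^2 <= 1],
    because [L S = - 1/2]. Accordingly [(psi / h)^2] has derivative [2 p K / h^2] with [K] nondecreasing, and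
    [K <= 0] since [psi] is bounded. *)
Lemma eigenfn_growth lam psi J lam' x1 : eigenfn gamma lam psi J -> lam <= lam' -> 0 <= x1 ->
  (forall x, x1 <= x -> 8 * lam' * (p x * G x) ^ 2 <= 1) ->
  forall x, x1 <= x -> psi x ^ 2 <= psi x1 ^ 2 * exp (8 * lam' * (L - S x1)).
Proof.
  intros He Hle Hx1 HG x Hx.
  pose proof (eig_pos _ _ _ _ He) as Hlam.
  set (c := 4 * lam').
  set (K := fun x => psi x * J x - c * (G x * psi x ^ 2)).
  set (F := fun x => psi x ^ 2 * exp (- 2 * c * S x)).
  assert (HpG : forall y, m y * (p y * G y) = G y).
  { intros y; rewrite <- Rmult_assoc, (Rmult_comm (m y)), exp_gamma_mult; ring. }
  assert (HdF : forall y, is_derive F y (2 * p y * K y * exp (- 2 * c * S y))).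
  { intros y; unfold F, K.
    pose proof (eig_derive _ _ _ _ He y) as E1; pose proof (entrance_derive y) as E2.
    auto_derive; [split; [|split; auto]; eexists; eauto|].
    derive_subst E1; derive_subst E2.
    ring. }
  assert (HdK : forall y, 0 <= y -> is_derive K y
     (p y * (J y - c * G y * psi y) ^ 2 + m y * psi y ^ 2 * (c - 2 * lam - c ^ 2 * (p y * G y) ^ 2))).
  { intros y Hy; unfold K.
    pose proof (eig_derive _ _ _ _ He y) as E1; pose proof (tail_derive y) as E2.
    pose proof (flux_derive _ _ _ _ He y Hy) as E3.
    auto_derive; [repeat split; auto; eexists; eauto|].
    derive_subst E1; derive_subst E2; derive_subst E3.
    replace (m y * psi y ^ 2 * (c - 2 * lam - c ^ 2 * (p y * G y) ^ 2)) with
      (m y * psi y ^ 2 * (c - 2 * lam) - c ^ 2 * psi y ^ 2 * (m y * (p y * G y)) * (p y * G y)) by ring.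
    rewrite HpG; ring. }
  assert (HK : forall y z, x1 <= y <= z -> K y <= K z).
  { intros y z Hyz; apply (derive_nonneg_le _ _ y z (proj2 Hyz) (fun u Hu => HdK u ltac:(lra))).
    (* The hypothesis gives [c^2 (p G)^2 <= 2 lam'], hence [c - 2 lam - c^2 (p G)^2 >= 2 lam' - 2
       lam >= 0]; this is why [c = 4 lam']. *)
    intros u Hu; specialize (HG u ltac:(lra)).
    apply Rplus_le_le_0_compat.
    - apply Rmult_le_pos; [left; apply exp_pos|apply pow2_ge_0].
    - apply Rmult_le_pos; [apply Rmult_le_pos; [left; apply exp_pos|apply pow2_ge_0]|].
      unfold c; nra. }
  destruct (eig_bounded _ _ _ _ He) as [M HM].
  assert (Hc : 0 < c) by (unfold c; lra).
  assert (HKneg : forall y, x1 <= y -> K y <= 0).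
  { intros y Hy; apply Rnot_lt_le; intros Hpos.
    (* As [K] is nondecreasing and [S <= L], [F' >= d p] beyond [y]: [F] would outgrow its bound
       [M^2]. *)
    set (d := 2 * K y * exp (- 2 * c * L)).
    assert (Hdpos : 0 < d) by (unfold d; pose proof (exp_pos (- 2 * c * L)); nra).
    assert (HF : forall z, y <= z -> F y + d * (Lam z - Lam y) <= F z).
    { intros z Hz.
      assert (H : F y - d * Lam y <= F z - d * Lam z); [|lra].
      apply (derive_nonneg_le (fun z => F z - d * Lam z)
        (fun z => 2 * p z * K z * exp (- 2 * c * S z) - d * p z)); auto; intros u Hu.
      - apply (@is_derive_minus R_AbsRing R_NormedModule); [apply HdF|].
        apply @is_derive_scal, scale_derive.
      - pose proof (HK y u ltac:(lra)); pose proof (exp_pos (gamma u)).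
        assert (exp (- 2 * c * L) <= exp (- 2 * c * S u)).
        { apply exp_le; pose proof (entrance_le _ _ _ _ Hd u ltac:(lra)); nra. }
        pose proof (exp_pos (- 2 * c * L)).
        replace (_ - _) with (2 * p u * (K u * exp (- 2 * c * S u) - K y * exp (- 2 * c * L)))
          by (unfold d; ring).
        apply Rmult_le_pos; [lra|].
        assert (K y * exp (- 2 * c * L) <= K u * exp (- 2 * c * S u)); [|lra].
        apply Rmult_le_compat; lra. }
    destruct (scale_unbounded (Lam y + (M ^ 2 + 1) / d)) as [X [HX HLam]].
    set (z := Rmax X y).
    assert (Hz : y <= z) by apply Rmax_r.
    specialize (HLam z (Rmax_l _ _)); specialize (HF z Hz).
    assert (d * ((M ^ 2 + 1) / d) <= d * (Lam z - Lam y)) by (apply Rmult_le_compat_l; lra).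
    replace (d * ((M ^ 2 + 1) / d)) with (M ^ 2 + 1) in H by (field; lra).
    assert (0 <= F y) by (apply Rmult_le_pos; [apply pow2_ge_0|left; apply exp_pos]).
    assert (HFz : F z <= M ^ 2).
    { unfold F; rewrite <- (Rmult_1_r (M ^ 2)).
      apply Rmult_le_compat; [apply pow2_ge_0|left; apply exp_pos| |].
      - apply pow_maj_Rabs, HM; lra.
      - rewrite <- exp_0; apply exp_le.
        pose proof (entrance_nonneg z ltac:(lra)); nra. }
    lra. }
  assert (HF : - F x1 <= - F x).
  { apply (derive_nonneg_le (fun y => - F y) (fun y => - (2 * p y * K y * exp (- 2 * c * S y)))); auto; intros y Hy.
    - apply (@is_derive_opp R_AbsRing R_NormedModule), HdF.
    - specialize (HKneg y ltac:(lra)).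
      pose proof (exp_pos (gamma y)); pose proof (exp_pos (- 2 * c * S y)).
      replace (- _) with (2 * p y * exp (- 2 * c * S y) * - K y) by ring.
      repeat apply Rmult_le_pos; lra. }
  replace (psi x ^ 2) with (F x * exp (2 * c * S x)).
  2:{ unfold F; rewrite Rmult_assoc, <- exp_plus.
      replace (-2 * c * S x + 2 * c * S x) with 0 by ring; rewrite exp_0; ring. }
  apply Rle_trans with (F x1 * exp (2 * c * S x)).
  { apply Rmult_le_compat_r; [left; apply exp_pos|lra]. }
  unfold F; rewrite Rmult_assoc, <- exp_plus.
  apply Rmult_le_compat_l; [apply pow2_ge_0|].
  apply exp_le; pose proof (entrance_le _ _ _ _ Hd x ltac:(lra)); unfold c in *; nra.
Qed.

End Diffusion.

(** * Energy identities and growth of the eigenvalues *)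

Definition kron (j k : nat) : R := if Nat.eq_dec j k then 1 else 0.

Record eigenbasis (gamma : R -> R) (lam : nat -> R) (psi J : nat -> R -> R) (pinf : nat -> R) : Prop := {
  eb_eig : forall k, eigenfn gamma (lam k) (psi k) (J k);
  eb_incr : forall k, lam k < lam (S k);
  eb_lim : forall k, is_lim (psi k) p_infty (pinf k);
  eb_orth : forall j k,
    is_lim (fun X => RInt (fun x => psi j x * psi k x * (2 * exp (- gamma x))) 0 X) p_infty (kron j k);
  eb_complete : forall (f : R -> R) a b, 0 < a -> a < b -> cont f ->
    (forall x, x < a \/ b < x -> f x = 0) ->
    exists nf : R,
      RInt (fun x => f x ^ 2 * (2 * exp (- gamma x))) a b = nf /\
      infinite_sum (fun k => RInt (fun x => f x * psi k x * (2 * exp (- gamma x))) a b ^ 2) nf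
}.

(** With the eigenfunctions it is a finite spectral sum, with the fluxes [J] it is the flux of that
    sum. *)
Definition esum (psi : nat -> R -> R) (c : nat -> R) (N : nat) (x : R) : R :=
  sum_f_R0 (fun k => c k * psi k x) N.

Lemma is_lim_sum (u : nat -> R -> R) (l : nat -> R) N :
  (forall k, is_lim (u k) p_infty (l k)) ->
  is_lim (fun x => sum_f_R0 (fun k => u k x) N) p_infty (sum_f_R0 l N).
Proof.
  intros H; induction N as [|N IH]; simpl; [apply H|].
  now apply is_lim_plus'.
Qed.

Lemma is_lim_scal (u : R -> R) (l c : R) :
  is_lim u p_infty l -> is_lim (fun x => c * u x) p_infty (c * l).
Proof. intros H; apply (is_lim_scal_l u c p_infty l H). Qed.

Lemma is_lim_infty_le (f : R -> R) (l B X0 : R) : is_lim f p_infty l ->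
  (forall x, X0 <= x -> f x <= B) -> l <= B.
Proof.
  intros Hl Hb.
  apply (is_lim_le_loc f (fun _ => B) p_infty l B); auto; [|apply is_lim_const].
  exists X0; intros x Hx; apply Hb; lra.
Qed.

Lemma is_lim_infty_ge (f : R -> R) (l B X0 : R) : is_lim f p_infty l ->
  (forall x, X0 <= x -> B <= f x) -> B <= l.
Proof.
  intros Hl Hb.
  apply (is_lim_le_loc (fun _ => B) f p_infty B l); auto; [|apply is_lim_const].
  exists X0; intros x Hx; apply Hb; lra.
Qed.

Lemma sum_kron (d : nat -> R) k N :
  sum_f_R0 (fun j => d j * kron k j) N = if le_lt_dec k N then d k else 0.
Proof.
  induction N as [|N IH]; simpl.
  - unfold kron; destruct (le_lt_dec k 0), (Nat.eq_dec k 0); try lia; subst; lra.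
  - rewrite IH; unfold kron.
    destruct (le_lt_dec k N), (le_lt_dec k (S N)), (Nat.eq_dec k (S N)); try lia; subst; lra.
Qed.

Lemma cont_esum psi c N : (forall k, cont (psi k)) -> cont (esum psi c N).
Proof.
  intros H; apply (cont_sum (fun k x => c k * psi k x)); intros k.
  apply cont_mult; [apply cont_const|apply H].
Qed.

Lemma esum_mult u (c d : nat -> R) N x w :
  esum u c N x * esum u d N x * w =
  sum_f_R0 (fun k => sum_f_R0 (fun j => c k * d j * (u k x * u j x * w)) N) N.
Proof.
  unfold esum; set (B := sum_f_R0 (fun k => d k * u k x) N).
  replace (sum_f_R0 (fun k => c k * u k x) N * B * w) with (B * w * sum_f_R0 (fun k => c k * u k x) N) by ring.
  rewrite scal_sum; apply sum_eq; intros k _.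
  replace (c k * u k x * (B * w)) with (c k * u k x * w * B) by ring.
  unfold B; rewrite scal_sum; apply sum_eq; intros j _; ring.
Qed.

Section Basis.

Variables (q gamma : R -> R) (G0 L : R) (lam : nat -> R) (psi J : nat -> R -> R) (pinf : nat -> R).
Hypothesis Hd : diffusion q gamma G0 L.
Hypothesis Hb : eigenbasis gamma lam psi J pinf.

Local Notation p x := (exp (gamma x)).
Local Notation m x := (exp (- gamma x)).
Local Notation Lam := (scale gamma).
Local Notation G := (tail gamma G0).

Let Hg : cont gamma := gamma_cont _ _ _ _ Hd.
Let HLam : cont Lam := scale_cont _ _ _ _ Hd.
Let HG : cont G := tail_cont _ _ _ _ Hd.

Lemma psi_cont k : cont (psi k).
Proof. apply Hb. Qed.
Lemma J_cont k : cont (J k).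
Proof. apply Hb. Qed.
Lemma esum_psi_cont c N : cont (esum psi c N).
Proof. apply cont_esum, psi_cont. Qed.
Lemma esum_J_cont c N : cont (esum J c N).
Proof. apply cont_esum, J_cont. Qed.
Hint Resolve Hg HLam HG psi_cont J_cont esum_psi_cont esum_J_cont : cont_db.

Lemma lam_pos k : 0 < lam k.
Proof. apply (eig_pos _ _ _ _ (eb_eig _ _ _ _ _ Hb k)). Qed.

Lemma esum_derive c N x : is_derive (esum psi c N) x (p x * esum J c N x).
Proof.
  unfold esum; rewrite scal_sum.
  evar_last.
  - apply (is_derive_sum (fun k y => c k * psi k y) (fun k y => c k * (p y * J k y))); intros k.
    apply @is_derive_scal, (eb_eig _ _ _ _ _ Hb k).
  - apply sum_eq; intros; simpl; ring.
Qed.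

Lemma esum_flux_derive c N x : 0 <= x ->
  is_derive (esum J c N) x (- 2 * m x * esum psi (fun k => lam k * c k) N x).
Proof.
  intros Hx; unfold esum; rewrite scal_sum.
  evar_last.
  - apply (is_derive_sum (fun k y => c k * J k y) (fun k y => c k * (- 2 * lam k * m y * psi k y))); intros k.
    apply @is_derive_scal, (eb_eig _ _ _ _ _ Hb k), Hx.
  - apply sum_eq; intros; simpl; ring.
Qed.

Lemma esum_zero c N : esum psi c N 0 = 0.
Proof.
  unfold esum; apply sum_eq_R0; intros k _; rewrite (eig_zero _ _ _ _ (eb_eig _ _ _ _ _ Hb k)); ring.
Qed.

(** The flux is dominated by the vanishing tail [G]; this removes the boundary term at infinity in
    [esum_energy]. *)
Lemma flux_lim k : is_lim (J k) p_infty 0.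
Proof.
  destruct (eig_bounded _ _ _ _ (eb_eig _ _ _ _ _ Hb k)) as [M HM].
  assert (HJ := flux_bound _ _ _ _ Hd (lam k) (psi k) (J k) 0 M (eb_eig _ _ _ _ _ Hb k) (Rle_refl 0) HM).
  assert (HM0 : 0 <= M) by (apply Rle_trans with (2 := HM 0 (Rle_refl _)), Rabs_pos).
  pose proof (lam_pos k).
  assert (HC : 0 < 2 * lam k * M + 1) by nra.
  apply is_lim_spec; intros eps.
  destruct (tail_vanish _ _ _ _ Hd (eps / (2 * lam k * M + 1))) as [X [HX HX']].
  { apply Rdiv_lt_0_compat; [apply cond_pos|lra]. }
  exists X; intros x Hx; rewrite Rminus_0_r.
  specialize (HX' x ltac:(lra)); specialize (HJ x ltac:(lra)).
  pose proof (tail_nonneg _ _ _ _ Hd x ltac:(lra)).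
  apply Rle_lt_trans with (1 := HJ).
  apply (Rmult_lt_compat_r (2 * lam k * M + 1)) in HX'; [|lra].
  replace (eps / (2 * lam k * M + 1) * (2 * lam k * M + 1)) with (pos eps) in HX' by (field; lra); nra.
Qed.

Lemma esum_inner c d N :
  is_lim (fun X => RInt (fun x => esum psi c N x * esum psi d N x * (2 * m x)) 0 X) p_infty
    (sum_f_R0 (fun k => c k * d k) N).
Proof.
  apply is_lim_ext with (fun X => sum_f_R0 (fun k => sum_f_R0 (fun j =>
    c k * d j * RInt (fun x => psi k x * psi j x * (2 * m x)) 0 X) N) N).
  { intros X; symmetry.
    rewrite (RInt_ext_all _ (fun x => sum_f_R0 (fun k => sum_f_R0 (fun j =>
      c k * d j * (psi k x * psi j x * (2 * m x))) N) N)) by (intros; apply esum_mult).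
    rewrite (RInt_sum (fun k x => sum_f_R0 (fun j => c k * d j * (psi k x * psi j x * (2 * m x))) N)).
    2:{ intros k. apply (cont_sum (fun j x => c k * d j * (psi k x * psi j x * (2 * m x)))); intros j; ctac. }
    apply sum_eq; intros k _.
    rewrite (RInt_sum (fun j x => c k * d j * (psi k x * psi j x * (2 * m x)))) by (intros; ctac).
    apply sum_eq; intros j _.
    apply (RInt_scal_cont (fun x => psi k x * psi j x * (2 * m x))); ctac. }
  replace (sum_f_R0 (fun k => c k * d k) N) with
    (sum_f_R0 (fun k => sum_f_R0 (fun j => c k * d j * kron k j) N) N).
  - apply is_lim_sum; intros k; apply is_lim_sum; intros j.
    apply is_lim_scal, (eb_orth _ _ _ _ _ Hb).
  - apply sum_eq; intros k Hk.
    replace (fun j => c k * d j * kron k j) with (fun j => (fun j => c k * d j) j * kron k j) by reflexivity.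
    rewrite (sum_kron (fun j => c k * d j)); destruct (le_lt_dec k N); [ring|lia].
Qed.

Lemma esum_bessel c N X : 0 <= X ->
  RInt (fun x => esum psi c N x ^ 2 * (2 * m x)) 0 X <= sum_f_R0 (fun k => c k ^ 2) N.
Proof.
  intros HX.
  replace (sum_f_R0 (fun k => c k ^ 2) N) with (sum_f_R0 (fun k => c k * c k) N)
    by (apply sum_eq; intros; ring).
  apply (is_lim_infty_ge _ _ _ X (esum_inner c c N)); intros x Hx.
  rewrite (RInt_ext_all _ (fun x => esum psi c N x * esum psi c N x * (2 * m x))) by (intros; ring).
  apply RInt_nonneg_mono; [lra|ctac|].
  intros y Hy; apply Rmult_le_pos; [apply Rle_0_sqr|].
  pose proof (exp_pos (- gamma y)); lra.
Qed.

(** Integration by parts identifies the full integral of [F^2 p], the Dirichlet form of [phi], with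
    the sum of [lam_k c_k^2]. Since [phi x] is the integral of [F p] from 0, Cauchy-Schwarz brings
    in [Lam x], the integral of [p]. *)
Lemma esum_energy c N x : 0 <= x ->
  esum psi c N x ^ 2 <= Lam x * sum_f_R0 (fun k => lam k * c k ^ 2) N.
Proof.
  intros Hx.
  set (phi := esum psi c N); set (F := esum J c N).
  set (chi := esum psi (fun k => lam k * c k) N).
  assert (HE : forall X, 0 <= X ->
    RInt (fun y => F y ^ 2 * p y) 0 X = F X * phi X + RInt (fun y => phi y * chi y * (2 * m y)) 0 X).
  { intros X HX.
    assert (H : RInt (fun y => F y ^ 2 * p y + -1 * (phi y * chi y * (2 * m y))) 0 X = F X * phi X - F 0 * phi 0).
    { apply (RInt_ftc (fun y => F y * phi y)); auto.
      - unfold F, phi, chi; ctac.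
      - intros y Hy.
        assert (E1 := esum_flux_derive c N y ltac:(lra)); assert (E2 := esum_derive c N y).
        fold F in E1, E2; fold phi in E2; fold chi in E1.
        auto_derive; [split; [|split; auto]; eexists; eauto|].
        derive_subst E1; derive_subst E2; ring. }
    rewrite RInt_plus_cont, (RInt_scal_cont (fun y => phi y * chi y * (2 * m y))) in H;
      [|unfold F, phi, chi; ctac|unfold F, phi, chi; ctac|unfold F, phi, chi; ctac].
    assert (H0 : phi 0 = 0) by apply esum_zero.
    rewrite H0 in H; lra. }
  assert (Hlim : is_lim (fun X => F X * phi X + RInt (fun y => phi y * chi y * (2 * m y)) 0 X) p_infty
     (sum_f_R0 (fun k => lam k * c k ^ 2) N)).
  { replace (sum_f_R0 (fun k => lam k * c k ^ 2) N) with
      (sum_f_R0 (fun k => c k * 0) N * sum_f_R0 (fun k => c k * pinf k) N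
        + sum_f_R0 (fun k => c k * (lam k * c k)) N).
    - apply is_lim_plus'; [|apply esum_inner].
      apply (is_lim_mult F phi p_infty (sum_f_R0 (fun k => c k * 0) N) (sum_f_R0 (fun k => c k * pinf k) N)).
      + apply is_lim_sum; intros k; apply is_lim_scal, flux_lim.
      + apply is_lim_sum; intros k; apply is_lim_scal, Hb.
      + exact I.
    - replace (sum_f_R0 (fun k => c k * 0) N) with 0.
      + rewrite Rmult_0_l, Rplus_0_l; apply sum_eq; intros; ring.
      + symmetry; apply sum_eq_R0; intros; ring. }
  assert (Hint : RInt (fun y => F y ^ 2 * p y) 0 x <= sum_f_R0 (fun k => lam k * c k ^ 2) N).
  { apply (is_lim_infty_ge _ _ _ x Hlim); intros X HX; rewrite <- HE by lra.
    apply RInt_nonneg_mono; [lra|unfold F; ctac|].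
    intros y Hy; apply Rmult_le_pos; [apply pow2_ge_0|left; apply exp_pos]. }
  assert (Hphi : phi x = RInt (fun y => F y * 1 * p y) 0 x).
  { rewrite (RInt_ftc phi); auto.
    - unfold phi at 3; rewrite esum_zero; ring.
    - unfold F; ctac.
    - intros y Hy; unfold F; rewrite Rmult_1_r, Rmult_comm; apply esum_derive. }
  rewrite Hphi.
  eapply Rle_trans; [apply (RInt_cauchy_schwarz F (fun _ => 1) (fun y => p y)); auto; try (unfold F; ctac)|].
  { intros; left; apply exp_pos. }
  rewrite Rmult_comm; apply Rmult_le_compat; auto.
  - apply RInt_nonneg; auto; [ctac|]; intros; rewrite pow1, Rmult_1_l; left; apply exp_pos.
  - apply RInt_nonneg; auto; [unfold F; ctac|]; intros.
    apply Rmult_le_pos; [apply pow2_ge_0|left; apply exp_pos].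
  - right; unfold scale; apply RInt_ext_all; intros; ring.
Qed.

(** For [c_k = psi_k(x) / lam_k] both sides of the energy bound contain the same sum [s], which
    leaves [s^2 <= Lam s]. The full series is the Green function on the diagonal, and this is where
    [Lam] comes from. *)
Lemma green_bessel N x : 0 <= x -> sum_f_R0 (fun k => psi k x ^ 2 / lam k) N <= Lam x.
Proof.
  intros Hx.
  assert (H := esum_energy (fun k => psi k x / lam k) N x Hx).
  set (s := sum_f_R0 (fun k => psi k x ^ 2 / lam k) N) in *.
  replace (esum psi (fun k => psi k x / lam k) N x) with s in H.
  2:{ apply sum_eq; intros k _; pose proof (lam_pos k); field; lra. }
  replace (sum_f_R0 (fun k => lam k * (psi k x / lam k) ^ 2) N) with s in H.
  2:{ apply sum_eq; intros k _; pose proof (lam_pos k); field; lra. }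
  assert (Hs : 0 <= s).
  { apply cond_pos_sum; intros k; apply Rdiv_le_0_compat; [apply pow2_ge_0|apply lam_pos]. }
  pose proof (scale_nonneg _ _ _ _ Hd x Hx); nra.
Qed.

Lemma psi_le_scale k x : 0 <= x -> psi k x ^ 2 <= lam k * Lam x.
Proof.
  intros Hx; pose proof (lam_pos k) as Hk.
  assert (H : psi k x ^ 2 / lam k <= Lam x).
  { apply Rle_trans with (2 := green_bessel k x Hx).
    destruct k as [|k]; [right; reflexivity|].
    rewrite tech5.
    assert (0 <= sum_f_R0 (fun k => psi k x ^ 2 / lam k) k); [|lra].
    apply cond_pos_sum; intros j; apply Rdiv_le_0_compat; [apply pow2_ge_0|apply lam_pos]. }
  apply (Rmult_le_compat_l (lam k)) in H; [|lra].
  replace (lam k * (psi k x ^ 2 / lam k)) with (psi k x ^ 2) in H by (field; lra); lra.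
Qed.

(** [2 S - 2 Lam G] is an antiderivative vanishing at 0, and [Lam G >= 0]. *)
Lemma scale_speed_integral X : 0 <= X -> RInt (fun x => Lam x * (2 * m x)) 0 X <= 2 * L.
Proof.
  intros HX.
  rewrite (RInt_ftc (fun x => 2 * entrance gamma G0 x - 2 * (Lam x * G x))); auto; [|ctac|].
  - rewrite entrance_0, scale_0.
    pose proof (entrance_le _ _ _ _ Hd X HX).
    pose proof (Rmult_le_pos _ _ (scale_nonneg _ _ _ _ Hd X HX) (tail_nonneg _ _ _ _ Hd X HX)); lra.
  - intros x Hx.
    assert (E1 := scale_derive _ _ _ _ Hd x); assert (E2 := tail_derive _ _ _ _ Hd x).
    assert (E3 := entrance_derive _ _ _ _ Hd x).
    auto_derive; [repeat split; eexists; eauto|].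
    derive_subst E1; derive_subst E2; derive_subst E3; ring.
Qed.

(** A trace bound: [green_bessel] integrated against the speed measure, each [psi_k^2] having
    integral 1. *)
Lemma inv_eigenvalue_sum N : sum_f_R0 (fun k => / lam k) N <= 2 * L.
Proof.
  apply (is_lim_infty_le (fun X => sum_f_R0 (fun k =>
    / lam k * RInt (fun x => psi k x * psi k x * (2 * m x)) 0 X) N) _ _ 0).
  - apply is_lim_sum; intros k.
    evar_last; [apply is_lim_scal|apply (f_equal Finite), Rmult_1_r].
    assert (H := eb_orth _ _ _ _ _ Hb k k); unfold kron in H; destruct (Nat.eq_dec k k); [auto|lia].
  - intros X HX.
    apply Rle_trans with (2 := scale_speed_integral X HX).
    rewrite (sum_eq _ (fun k => RInt (fun x => / lam k * (psi k x * psi k x * (2 * m x))) 0 X)).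
    2:{ intros k _; symmetry; apply (RInt_scal_cont (fun x => psi k x * psi k x * (2 * m x))); ctac. }
    rewrite <- (RInt_sum (fun k x => / lam k * (psi k x * psi k x * (2 * m x)))) by (intros; ctac).
    apply RInt_le_cont; auto; [|ctac|].
    { apply (cont_sum (fun k x => / lam k * (psi k x * psi k x * (2 * m x)))); intros; ctac. }
    intros x Hx.
    rewrite (sum_eq _ (fun k => psi k x ^ 2 / lam k * (2 * m x))) by (intros; unfold Rdiv; ring).
    rewrite <- scal_sum, Rmult_comm.
    apply Rmult_le_compat_r; [pose proof (exp_pos (- gamma x)); lra|].
    apply green_bessel; lra.
Qed.

Lemma lam_mono j k : (j <= k)%nat -> lam j <= lam k.
Proof.
  induction 1 as [|k _ IH]; [lra|].
  pose proof (eb_incr _ _ _ _ _ Hb k); lra.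
Qed.

(** The first [k + 1] reciprocals are each at least [/ lam k], and their sum is at most [2 L]. *)
Lemma eigenvalue_growth k : INR (S k) <= 2 * L * lam k.
Proof.
  pose proof (lam_pos k) as Hk.
  assert (H := inv_eigenvalue_sum k).
  assert (H1 : sum_f_R0 (fun _ => / lam k) k <= sum_f_R0 (fun j => / lam j) k).
  { apply sum_Rle; intros j Hj; apply Rinv_le_contravar; [apply lam_pos|now apply lam_mono]. }
  rewrite sum_cte in H1.
  assert (H2 : / lam k * INR (S k) <= 2 * L) by lra.
  apply (Rmult_le_compat_r (lam k)) in H2; [|lra].
  replace (/ lam k * INR (S k) * lam k) with (INR (S k)) in H2 by (field; lra); lra.
Qed.

End Basis.

(** * Sup-norm bounds on eigenfunctions *)

Section Sup_bound.

Variables (q gamma dq : R -> R) (G0 L a x0 : R).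
Hypothesis Hd : diffusion q gamma G0 L.
Hypothesis Hdq : exists X, 0 <= X /\
  forall x, X <= x -> is_derive q x (dq x) /\ Rabs (dq x) <= / 2 * q x ^ 2.
Hypothesis Ha : 0 < a.
Hypothesis Halmost : forall x y, x0 <= x -> x <= y -> a * q x <= q y.

Local Notation p x := (exp (gamma x)).
Local Notation m x := (exp (- gamma x)).
Local Notation Lam := (scale gamma).
Local Notation G := (tail gamma G0).
Local Notation S := (entrance gamma G0).

Lemma speed_div_drift_derive x : 0 < q x -> is_derive q x (dq x) ->
  is_derive (fun x => m x / q x) x (- m x * (2 + dq x / q x ^ 2)).
Proof.
  intros Hq E1; assert (E2 := gamma_derive _ _ _ _ Hd x).
  auto_derive; [repeat split; try lra; eexists; eauto|].
  derive_subst E1; derive_subst E2; field; lra.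
Qed.

(** [G] is compared with [m / q], whose derivative [- m (2 + q' / q^2)] lies between [- 5/2 m] and
    [- 3/2 m]. So [G - m / q] and [m / (4 q) - G] are nondecreasing, and both tend to 0. The
    constants bracket the expected equivalent [1 / (2 q)] of [p G]. *)
Lemma tail_asymptotics : exists X, 0 <= X /\ forall x, X <= x ->
  1 <= q x /\ / (4 * q x) <= p x * G x /\ p x * G x <= / q x.
Proof.
  destruct Hdq as [X1 [HX1 H1]].
  destruct (drift_infty _ _ _ _ Hd 1) as [X2 [HX2 H2]].
  set (X := Rmax X1 X2).
  assert (HXX1 : X1 <= X) by apply Rmax_l; assert (HXX2 : X2 <= X) by apply Rmax_r.
  assert (Hq : forall x, X <= x -> 1 <= q x) by (intros; apply H2; lra).
  assert (Hr : forall x, X <= x -> Rabs (dq x / q x ^ 2) <= / 2).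
  { intros x Hx; specialize (Hq x Hx); destruct (H1 x ltac:(lra)) as [_ Hb].
    unfold Rdiv; rewrite Rabs_mult, Rabs_inv, (Rabs_pos_eq (q x ^ 2)) by nra.
    apply (Rmult_le_reg_r (q x ^ 2)); [nra|].
    rewrite Rmult_assoc, Rinv_l by nra; lra. }
  assert (Hder : forall x, X <= x ->
    is_derive (fun x => m x / q x) x (- m x * (2 + dq x / q x ^ 2))).
  { intros x Hx; apply speed_div_drift_derive; [specialize (Hq x Hx); lra|apply H1; lra]. }
  assert (Hmono : forall x y, X <= x <= y -> m y <= m x).
  { intros x y Hxy; apply exp_le.
    enough (gamma x <= gamma y) by lra.
    apply derive_nonneg_le with (fun x => 2 * q x); [lra| |]; intros z Hz; [apply Hd|].
    specialize (Hq z ltac:(lra)); lra. }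
  exists X; split; [lra|]; intros x Hx; split; [auto|].
  assert (Hup : G x <= m x / q x).
  { apply le_epsilon; intros eps Heps.
    destruct (tail_vanish _ _ _ _ Hd eps Heps) as [Y [HY HY']].
    set (y := Rmax x Y); assert (x <= y) by apply Rmax_l; assert (Y <= y) by apply Rmax_r.
    assert (Hle : G x - m x / q x <= G y - m y / q y).
    { apply (derive_nonneg_le (fun z => G z - m z / q z)
        (fun z => - m z - - m z * (2 + dq z / q z ^ 2))); auto; intros z Hz.
      - apply (@is_derive_minus R_AbsRing R_NormedModule); [apply (tail_derive _ _ _ _ Hd)|].
        apply Hder; lra.
      - specialize (Hr z ltac:(lra)); apply Rabs_le_between in Hr.
        pose proof (exp_pos (- gamma z)).
        replace (_ - _) with (m z * (1 + dq z / q z ^ 2)) by ring.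
        apply Rmult_le_pos; lra. }
    specialize (HY' y H0).
    assert (0 <= m y / q y).
    { apply Rdiv_le_0_compat; [left; apply exp_pos|specialize (Hq y ltac:(lra)); lra]. }
    lra. }
  assert (Hlow : / 4 * (m x / q x) <= G x).
  { apply le_epsilon; intros eps Heps.
    (* [m] is nonincreasing beyond [X], so [q y >= m X / eps] forces [m y / q y <= eps]. *)
    destruct (drift_infty _ _ _ _ Hd (m X / eps)) as [Y [HY HY']].
    set (y := Rmax x Y); assert (x <= y) by apply Rmax_l; assert (Y <= y) by apply Rmax_r.
    assert (Hle : / 4 * (m x / q x) - G x <= / 4 * (m y / q y) - G y).
    { apply (derive_nonneg_le (fun z => / 4 * (m z / q z) - G z)
        (fun z => / 4 * (- m z * (2 + dq z / q z ^ 2)) - - m z)); auto; intros z Hz.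
      - apply (@is_derive_minus R_AbsRing R_NormedModule); [|apply (tail_derive _ _ _ _ Hd)].
        apply @is_derive_scal, Hder; lra.
      - specialize (Hr z ltac:(lra)); apply Rabs_le_between in Hr.
        pose proof (exp_pos (- gamma z)).
        replace (_ - _) with (m z * (/ 2 - / 4 * (dq z / q z ^ 2)))
          by (specialize (Hq z ltac:(lra)); field; lra).
        apply Rmult_le_pos; lra. }
    pose proof (tail_nonneg _ _ _ _ Hd y ltac:(lra)).
    assert (m y / q y <= eps).
    { specialize (HY' y H0); specialize (Hq y ltac:(lra)).
      apply (Rmult_le_reg_r (q y)); [lra|].
      replace (m y / q y * q y) with (m y) by (field; lra).
      apply Rle_trans with (m X); [apply Hmono; lra|].
      apply (Rmult_le_compat_l eps) in HY'; [|lra].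
      replace (eps * (m X / eps)) with (m X) in HY' by (field; lra); lra. }
    assert (0 <= m y / q y).
    { apply Rdiv_le_0_compat; [left; apply exp_pos|specialize (Hq y ltac:(lra)); lra]. }
    lra. }
  specialize (Hq x Hx); pose proof (exp_pos (gamma x)); pose proof (exp_gamma_mult gamma x) as Hpm.
  split.
  - replace (/ (4 * q x)) with (p x * (/ 4 * (m x / q x))).
    + apply Rmult_le_compat_l; lra.
    + replace (p x * (/ 4 * (m x / q x))) with (p x * m x * (/ 4 * / q x)) by (field; lra).
      rewrite Hpm; field; lra.
  - replace (/ q x) with (p x * (m x / q x)).
    + apply Rmult_le_compat_l; lra.
    + unfold Rdiv; rewrite <- Rmult_assoc, Hpm; ring.
Qed.

(** On [[x / 2, x]], (H3) gives [q y <= q x / a], hence [S' >= 1 / (4 q y) >= a / (4 q x)]. The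
    increment of [S] over this interval is thus at least [a x / (8 q x)], and it tends to 0 because
    [S] converges. *)
Lemma id_little_o_drift eps : 0 < eps -> exists X, 0 <= X /\ forall x, X <= x -> x <= eps * q x.
Proof.
  intros Heps.
  destruct tail_asymptotics as [X1 [HX1 H1]].
  destruct (entrance_lim _ _ _ _ Hd (a * eps / 8)) as [X2 [HX2 H2]].
  { apply Rdiv_lt_0_compat; [apply Rmult_lt_0_compat|]; lra. }
  set (X := Rmax (Rmax X1 X2) x0).
  assert (HXX1 : X1 <= X) by (eapply Rle_trans; [apply Rmax_l|apply Rmax_l]).
  assert (HXX2 : X2 <= X) by (eapply Rle_trans; [apply Rmax_r|apply Rmax_l]).
  assert (HXX3 : x0 <= X) by apply Rmax_r.
  exists (2 * X); split; [lra|]; intros x Hx.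
  destruct (H1 x ltac:(lra)) as [Hqx _].
  set (c := a / (4 * q x)).
  assert (Hc : 0 < c) by (apply Rdiv_lt_0_compat; lra).
  assert (HS : S (x / 2) - c * (x / 2) <= S x - c * x).
  { apply (derive_nonneg_le (fun y => S y - c * y) (fun y => p y * G y - c)); [lra| |]; intros y Hy.
    - evar_last.
      + apply (@is_derive_minus R_AbsRing R_NormedModule); [apply (entrance_derive _ _ _ _ Hd)|].
        apply @is_derive_scal, @is_derive_id.
      + unfold minus, plus, opp, one; simpl; ring.
    - destruct (H1 y ltac:(lra)) as [Hqy [Hl _]].
      pose proof (Halmost y x ltac:(lra) ltac:(lra)) as Hal.
      assert (c <= / (4 * q y)); [|lra].
      unfold c; apply (Rmult_le_reg_r (4 * q x * q y)); [nra|].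
      replace (a / (4 * q x) * (4 * q x * q y)) with (a * q y) by (field; lra).
      replace (/ (4 * q y) * (4 * q x * q y)) with (q x) by (field; lra); lra. }
  pose proof (entrance_le _ _ _ _ Hd x ltac:(lra)).
  specialize (H2 (x / 2) ltac:(lra)).
  assert (H3 : c * (x / 2) <= a * eps / 8) by lra.
  apply (Rmult_le_compat_r (8 * q x / a)) in H3.
  - replace (c * (x / 2) * (8 * q x / a)) with x in H3 by (unfold c; field; lra).
    replace (a * eps / 8 * (8 * q x / a)) with (eps * q x) in H3 by (field; lra); lra.
  - left; apply Rdiv_lt_0_compat; lra.
Qed.

(** The matching point [x1] is where [q] reaches [sqrt (8 lam') / a]; there [gamma x1] is at most of
    order [x1 q(x1) = o(q(x1)^2) = o(lam')], and beyond it [eigenfn_growth] loses only a factor [exp (o(lam'))]. *)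
Lemma eigenfn_sup_bound tau : 0 < tau -> exists C, 0 < C /\
  forall lam psi J, eigenfn gamma lam psi J ->
  (forall x, 0 <= x -> psi x ^ 2 <= lam * Lam x) ->
  forall x, 0 <= x -> psi x ^ 2 <= C * exp (tau * lam).
Proof.
  intros Htau.
  (* The three bounds serve, in order, the estimate of [x1], the growth factor beyond [x1], and the
     increment of [gamma] up to [x1]. *)
  set (eps := Rmin 1 (Rmin (tau / 64) (tau * a ^ 3 / 128))).
  assert (Ha3 : 0 < a ^ 3) by (apply pow_lt; lra).
  assert (Heps : 0 < eps /\ eps <= 1 /\ eps <= tau / 64 /\ eps <= tau * a ^ 3 / 128).
  { unfold eps; repeat split.
    - repeat apply Rmin_pos; try lra; apply Rdiv_lt_0_compat; try lra; apply Rmult_lt_0_compat; lra.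
    - apply Rmin_l.
    - eapply Rle_trans; [apply Rmin_r|apply Rmin_l].
    - eapply Rle_trans; [apply Rmin_r|apply Rmin_r]. }
  destruct Heps as [Heps [Heps1 [Heps2 Heps3]]].
  destruct tail_asymptotics as [X1 [HX1 H1]].
  destruct (id_little_o_drift eps Heps) as [X2 [HX2 H2]].
  destruct (entrance_lim _ _ _ _ Hd eps Heps) as [X3 [HX3 H3]].
  set (X := Rmax (Rmax X1 X2) (Rmax X3 x0)).
  assert (HXX1 : X1 <= X) by (eapply Rle_trans; [apply Rmax_l|apply Rmax_l]).
  assert (HXX2 : X2 <= X) by (eapply Rle_trans; [apply Rmax_r|apply Rmax_l]).
  assert (HXX3 : X3 <= X) by (eapply Rle_trans; [apply Rmax_l|apply Rmax_r]).
  assert (HXX4 : x0 <= X) by (eapply Rle_trans; [apply Rmax_r|apply Rmax_r]).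
  (* Replacing [lam] by [l = Rmax lam ls] ensures [q X <= v], so that the intermediate value theorem
     finds [x1] to the right of [X] even for small eigenvalues. The price is the constant factor
     [exp (tau ls)]. *)
  set (ls := Rmax 1 (a ^ 2 * q X ^ 2 / 8)).
  assert (Hls1 : 1 <= ls) by apply Rmax_l.
  assert (Hls2 : a ^ 2 * q X ^ 2 / 8 <= ls) by apply Rmax_r.
  assert (Ha2 : 0 < a ^ 2) by (apply pow_lt; lra).
  set (B := 1 + 64 / (a ^ 2 * tau)).
  assert (HB : 0 < B).
  { assert (0 < 64 / (a ^ 2 * tau)); [|unfold B; lra].
    apply Rdiv_lt_0_compat; [lra|apply Rmult_lt_0_compat; lra]. }
  pose proof (exp_pos (gamma X)) as Hp0.
  pose proof (scale_nonneg _ _ _ _ Hd X ltac:(lra)) as HL0.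
  exists (8 / tau * (Lam X + B * p X) * exp (tau * ls)); split.
  { apply Rmult_lt_0_compat; [|apply exp_pos].
    apply Rmult_lt_0_compat; [apply Rdiv_lt_0_compat; lra|nra]. }
  intros lam psi J He Hpsi.
  pose proof (eig_pos _ _ _ _ He) as Hlam.
  set (l := Rmax lam ls).
  assert (Hl1 : lam <= l) by apply Rmax_l; assert (Hl2 : ls <= l) by apply Rmax_r.
  assert (Hl3 : l <= lam + ls) by (unfold l, Rmax; destruct (Rle_dec lam ls); lra).
  set (v := sqrt (8 * l) / a).
  assert (Hv : v ^ 2 = 8 * l / a ^ 2).
  { unfold v, Rdiv; rewrite Rpow_mult_distr, pow2_sqrt by lra; rewrite pow_inv; reflexivity. }
  assert (Hv0 : 0 < v) by (apply Rdiv_lt_0_compat; [apply sqrt_lt_R0|]; lra).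
  assert (HqX : q X <= v).
  { destruct (H1 X ltac:(lra)) as [HqX _].
    apply Rsqr_incr_0; [|lra|lra].
    rewrite !Rsqr_pow2, Hv; apply (Rmult_le_reg_r (a ^ 2)); [lra|].
    replace (8 * l / a ^ 2 * a ^ 2) with (8 * l) by (field; lra); lra. }
  destruct (drift_infty _ _ _ _ Hd v) as [Y [HY HY']].
  set (Y' := Rmax X Y).
  assert (HXY : X <= Y') by apply Rmax_l.
  specialize (HY' Y' (Rmax_r _ _)).
  destruct (IVT_gen q X Y' v) as [x1 [Hx1 Hqx1]].
  { intros z; apply continuity_pt_filterlim, Hd. }
  { split; [eapply Rle_trans; [apply Rmin_l|lra]|eapply Rle_trans; [|apply Rmax_r]; lra]. }
  rewrite Rmin_left, Rmax_right in Hx1 by lra.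
  (* The unit of loss: [l], [x1], [p x1] and the growth factor beyond [x1] cost one [E] each, up to
     constants, and [E^4 = exp (tau l / 2)]. *)
  set (E := exp (tau * l / 8)).
  assert (HE1 : 1 + tau * l / 8 <= E) by (apply exp_ineq1_le).
  assert (Htl : 0 < tau * l) by (apply Rmult_lt_0_compat; lra).
  assert (HlE : l <= 8 / tau * E).
  { apply (Rmult_le_reg_l (tau / 8)); [lra|].
    replace (tau / 8 * (8 / tau * E)) with E by (field; lra); lra. }
  assert (Hx1E : x1 <= B * E).
  { specialize (H2 x1 ltac:(lra)); rewrite Hqx1 in H2.
    assert (v <= 1 + v ^ 2) by nra.
    assert (eps * v <= v) by nra.
    assert (v ^ 2 <= 64 / (a ^ 2 * tau) * E).
    { rewrite Hv; replace (64 / (a ^ 2 * tau) * E) with (8 * (8 / tau * E) / a ^ 2) by (field; lra).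
      apply Rmult_le_compat_r; [left; apply Rinv_0_lt_compat; lra|lra]. }
    unfold B; lra. }
  assert (Hg : gamma x1 <= gamma X + tau * l / 8).
  { assert (Hgl : 2 * v / a * X - gamma X <= 2 * v / a * x1 - gamma x1).
    { apply (derive_nonneg_le (fun y => 2 * v / a * y - gamma y) (fun y => 2 * v / a - 2 * q y)); [lra| |]; intros y Hy.
      - evar_last.
        + apply (@is_derive_minus R_AbsRing R_NormedModule); [|apply Hd].
          apply @is_derive_scal, @is_derive_id.
        + unfold minus, plus, opp, one; simpl; ring.
      - pose proof (Halmost y x1 ltac:(lra) ltac:(lra)) as Hal; rewrite Hqx1 in Hal.
        apply (Rmult_le_reg_r a); [lra|].
        replace ((2 * v / a - 2 * q y) * a) with (2 * v - 2 * q y * a) by (field; lra); lra. }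
    specialize (H2 x1 ltac:(lra)); rewrite Hqx1 in H2.
    assert (Hva : 0 < 2 * v / a) by (apply Rdiv_lt_0_compat; lra).
    assert (2 * v / a * (x1 - X) <= 2 * v / a * (eps * v)) by (apply Rmult_le_compat_l; lra).
    replace (2 * v / a * (eps * v)) with (2 * eps / a * v ^ 2) in H by (field; lra).
    rewrite Hv in H.
    replace (2 * eps / a * (8 * l / a ^ 2)) with (eps * (16 * l / a ^ 3)) in H by (field; lra).
    assert (Hla : 0 <= 16 * l / a ^ 3) by (apply Rdiv_le_0_compat; lra).
    assert (eps * (16 * l / a ^ 3) <= tau * a ^ 3 / 128 * (16 * l / a ^ 3)) by (apply Rmult_le_compat_r; lra).
    replace (tau * a ^ 3 / 128 * (16 * l / a ^ 3)) with (tau * l / 8) in H0 by (field; lra).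
    lra. }
  assert (Hp1 : p x1 <= p X * E) by (unfold E; rewrite <- exp_plus; now apply exp_le).
  assert (HL1 : Lam x1 <= Lam X + B * E * (p X * E)).
  { assert (H : p x1 * X - Lam X <= p x1 * x1 - Lam x1).
    { apply (derive_nonneg_le (fun y => p x1 * y - Lam y) (fun y => p x1 - p y)); [lra| |]; intros y Hy.
      - evar_last.
        + apply (@is_derive_minus R_AbsRing R_NormedModule); [|apply (scale_derive _ _ _ _ Hd)].
          apply @is_derive_scal, @is_derive_id.
        + unfold minus, plus, opp, one; simpl; ring.
      - enough (p y <= p x1) by lra.
        apply exp_le, derive_nonneg_le with (fun x => 2 * q x); [lra| |]; intros z Hz; [apply Hd|].
        destruct (H1 z ltac:(lra)); lra. }
    pose proof (exp_pos (gamma x1)).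
    assert (p x1 * x1 <= p X * E * (B * E)) by (apply Rmult_le_compat; lra).
    nra. }
  assert (HE4 : E * E * E * E <= exp (tau * ls) * exp (tau * lam)).
  { unfold E; rewrite <- !exp_plus; apply exp_le; nra. }
  assert (Hfin : l * Lam x1 * E <= 8 / tau * (Lam X + B * p X) * exp (tau * ls) * exp (tau * lam)).
  { assert (HEge : 1 <= E) by lra.
    assert (HLE : Lam x1 <= (Lam X + B * p X) * (E * E)).
    { assert (Lam X * 1 <= Lam X * (E * E)) by (apply Rmult_le_compat_l; nra); nra. }
    pose proof (scale_nonneg _ _ _ _ Hd x1 ltac:(lra)).
    apply Rle_trans with (8 / tau * E * ((Lam X + B * p X) * (E * E)) * E).
    - apply Rmult_le_compat_r; [lra|]; apply Rmult_le_compat; lra.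
    - replace (8 / tau * E * ((Lam X + B * p X) * (E * E)) * E) with
        (8 / tau * (Lam X + B * p X) * (E * E * E * E)) by ring.
      rewrite (Rmult_assoc _ (exp (tau * ls))); apply Rmult_le_compat_l; auto.
      apply Rmult_le_pos; [left; apply Rdiv_lt_0_compat; lra|nra]. }
  assert (Hx1sq : forall x, 0 <= x <= x1 -> psi x ^ 2 <= l * Lam x1).
  { intros x Hx; apply Rle_trans with (1 := Hpsi x ltac:(lra)).
    apply Rmult_le_compat; [lra|now apply (scale_nonneg _ _ _ _ Hd)|lra|apply (scale_mono _ _ _ _ Hd); lra]. }
  intros x Hx; destruct (Rle_lt_dec x x1) as [Hxx|Hxx].
  - apply Rle_trans with (2 := Hfin).
    pose proof (Hx1sq x ltac:(lra)).
    assert (0 <= l * Lam x1) by (eapply Rle_trans; [apply pow2_ge_0|eauto]).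
    nra.
  - apply Rle_trans with (2 := Hfin).
    apply Rle_trans with (psi x1 ^ 2 * exp (8 * l * (L - S x1))).
    + apply (eigenfn_growth q gamma G0 L Hd lam psi J); auto; [lra| |lra].
      intros y Hy; destruct (H1 y ltac:(lra)) as [Hqy [_ Hub]].
      pose proof (Halmost x1 y ltac:(lra) ltac:(lra)) as Hal; rewrite Hqx1 in Hal.
      (* (H3) gives [q y >= a v = sqrt (8 l)] beyond [x1]; with [p G <= / q] this is the smallness
         required by [eigenfn_growth]. *)
      assert (H8 : 8 * l <= q y ^ 2).
      { replace (8 * l) with ((a * v) ^ 2); [|rewrite Rpow_mult_distr, Hv; field; lra].
        apply pow_incr; nra. }
      assert (Hpos : 0 <= p y * G y).
      { apply Rmult_le_pos; [left; apply exp_pos|apply Hd; lra]. }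
      assert (H9 : (p y * G y) ^ 2 <= (/ q y) ^ 2) by (apply pow_incr; lra).
      apply Rle_trans with (q y ^ 2 * (/ q y) ^ 2).
      * apply Rmult_le_compat; try lra; apply pow2_ge_0.
      * right; field; lra.
    + apply Rmult_le_compat; [apply pow2_ge_0|left; apply exp_pos|apply Hx1sq; lra|].
      apply exp_le; specialize (H3 x1 ltac:(lra)).
      assert (l * (L - S x1) <= l * (tau / 64)) by (apply Rmult_le_compat_l; lra).
      lra.
Qed.

End Sup_bound.

(** * Comparison for the implicit Euler scheme *)

(** With [z = y / (n + 1)], raise [exp (- z) <= / (1 + z) <= exp (- z / (1 + z))] to the power
    [n + 1]. *)
Lemma euler_exp_lim y : 0 < y ->
  is_lim_seq (fun n => (/ (1 + y / INR (S n))) ^ S n) (exp (- y)).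
Proof.
  intros Hy.
  assert (HS : forall n, 0 < INR (S n)) by (intros; apply lt_0_INR; lia).
  apply is_lim_seq_le_le with (fun _ => exp (- y)) (fun n => exp (- y / (1 + y / INR (S n)))).
  - intros n; specialize (HS n).
    set (z := y / INR (S n)).
    assert (Hz : 0 < z) by (apply Rdiv_lt_0_compat; lra).
    split.
    + replace (- y) with (INR (S n) * - z) by (unfold z; field; lra).
      rewrite <- exp_pow; apply pow_incr; split; [left; apply exp_pos|].
      rewrite exp_Ropp; apply Rinv_le_contravar; [lra|].
      apply exp_ineq1_le.
    + assert (Hy2 : y = INR (S n) * z) by (unfold z; field; lra).
      replace (- y / (1 + z)) with (INR (S n) * (- z / (1 + z))) by (rewrite Hy2; field; lra).
      rewrite <- exp_pow; apply pow_incr; split; [left; apply Rinv_0_lt_compat; lra|].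
      replace (/ (1 + z)) with (1 + - z / (1 + z)) by (field; lra).
      apply exp_ineq1_le.
  - apply is_lim_seq_const.
  - assert (H : is_lim_seq (fun n => - y / (1 + y / INR (S n))) (- y / (1 + y * 0))).
    { apply is_lim_seq_div'; [apply is_lim_seq_const| |lra].
      apply is_lim_seq_plus'; [apply is_lim_seq_const|].
      apply is_lim_seq_mult'; [apply is_lim_seq_const|].
      apply (is_lim_seq_inv (fun n => INR (S n)) p_infty); [|discriminate].
      apply (is_lim_seq_incr_1 INR), is_lim_seq_INR. }
    replace (- y / (1 + y * 0)) with (- y) in H by field.
    apply (is_lim_seq_continuous exp _ (- y)); auto.
    apply continuity_pt_filterlim, continuous_exp.
Qed.

Lemma is_lim_seq_sum (u : nat -> nat -> R) (l : nat -> R) N :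
  (forall k, is_lim_seq (u k) (l k)) ->
  is_lim_seq (fun n => sum_f_R0 (fun k => u k n) N) (sum_f_R0 l N).
Proof.
  intros H; induction N as [|N IH]; simpl; [apply H|].
  now apply is_lim_seq_plus'.
Qed.

Lemma RInt_support f a b X : cont f -> 0 <= a -> a <= b -> b <= X ->
  (forall x, x < a \/ b < x -> f x = 0) -> RInt f 0 X = RInt f a b.
Proof.
  intros Hf Ha Hab HX H0.
  rewrite <- (RInt_Chasles_cont f 0 a X), <- (RInt_Chasles_cont f a b X) by auto.
  rewrite (RInt_ext f (fun _ => 0) 0 a), (RInt_ext f (fun _ => 0) b X).
  - rewrite !(RInt_const (V := R_CompleteNormedModule)); unfold scal; simpl; unfold mult; simpl; ring.
  - intros x; rewrite Rmin_left, Rmax_right by lra; intros; apply H0; lra.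
  - intros x; rewrite Rmin_left, Rmax_right by lra; intros; apply H0; lra.
Qed.

Lemma esum_abs_le psi (c B : nat -> R) N x : (forall k, Rabs (psi k x) <= B k) ->
  Rabs (esum psi c N x) <= sum_f_R0 (fun k => Rabs (c k) * B k) N.
Proof.
  intros H; unfold esum.
  eapply Rle_trans; [apply Rsum_abs|].
  apply sum_Rle; intros k _; rewrite Rabs_mult.
  apply Rmult_le_compat_l; [apply Rabs_pos|auto].
Qed.

Section Comparison.

Variables (q gamma : R -> R) (G0 L : R) (lam : nat -> R) (psi J : nat -> R -> R) (pinf : nat -> R).
Hypothesis Hd : diffusion q gamma G0 L.
Hypothesis Hb : eigenbasis gamma lam psi J pinf.

Local Notation p x := (exp (gamma x)).
Local Notation m x := (exp (- gamma x)).
Local Notation Lam := (scale gamma).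
Local Notation G := (tail gamma G0).

Let Hg : cont gamma := gamma_cont _ _ _ _ Hd.
Let HLam : cont Lam := scale_cont _ _ _ _ Hd.
Let Hpsi : forall k, cont (psi k) := psi_cont _ _ _ _ _ Hb.
Let Hes : forall c N, cont (esum psi c N) := esum_psi_cont _ _ _ _ _ Hb.
Let Hlam : forall k, 0 < lam k := lam_pos _ _ _ _ _ Hb.
Hint Resolve Hg HLam Hpsi Hes : cont_db.

(** One implicit step is the resolvent [(1 - h L)^-1], which multiplies the coefficient on [psi_k]
    by [/ (1 + lam_k h)]. *)
Definition euler_coef (h : R) (n : nat) (d : nat -> R) (k : nat) : R := (/ (1 + lam k * h)) ^ n * d k.

Lemma euler_factor h k : 0 < h -> 0 < / (1 + lam k * h) <= 1.
Proof.
  intros Hh; assert (0 < lam k * h) by (apply Rmult_lt_0_compat; auto).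
  split; [apply Rinv_0_lt_compat; lra|].
  rewrite <- Rinv_1; apply Rinv_le_contravar; lra.
Qed.

Lemma euler_factor_pow h k n : 0 < h -> 0 < (/ (1 + lam k * h)) ^ n <= 1.
Proof.
  intros Hh; destruct (euler_factor h k Hh) as [H0 H1]; split.
  - now apply pow_lt.
  - assert (H : (/ (1 + lam k * h)) ^ n <= 1 ^ n) by (apply pow_incr; lra).
    now rewrite pow1 in H.
Qed.

(** A finite spectral sum solves the scheme exactly and [w] is a discrete subsolution with flux
    [wj], so [1 - h L] applied to their difference at step [i + 1] is at least the difference at
    step [i]. The induction applies [resolvent_max_principle] once per step. *)
Lemma euler_comparison N d h X n (w wj dwj : nat -> R -> R) : 0 < h -> 0 < X ->
  (forall i x, 0 <= x <= X -> is_derive (w i) x (p x * wj i x)) ->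
  (forall i x, 0 <= x <= X -> is_derive (wj i) x (dwj i x)) ->
  (forall i x, 0 < x < X -> w (S i) x - h / 2 * p x * dwj (S i) x <= w i x) ->
  (forall x, 0 <= x <= X -> w 0%nat x <= esum psi d N x) ->
  (forall i, (i <= n)%nat -> w i 0 <= 0) ->
  (forall i, (i <= n)%nat -> w i X <= esum psi (euler_coef h i d) N X) ->
  forall i, (i <= n)%nat -> forall x, 0 <= x <= X -> w i x <= esum psi (euler_coef h i d) N x.
Proof.
  intros Hh HX H1 H2 H3 H4 H5 H6 i; induction i as [|i IH]; intros Hi x Hx.
  - replace (esum psi (euler_coef h 0 d) N x) with (esum psi d N x); [auto|].
    apply sum_eq; intros k _; unfold euler_coef; simpl; ring.
  - set (u := esum psi (euler_coef h (S i) d) N).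
    set (uj := esum J (euler_coef h (S i) d) N).
    set (us := esum psi (fun k => lam k * euler_coef h (S i) d k) N).
    enough (0 <= u x - w (S i) x) by lra.
    apply (resolvent_max_principle (fun x => p x) (fun x => u x - w (S i) x) (fun x => uj x - wj (S i) x)
      (fun x => - 2 * m x * us x - dwj (S i) x) h X); auto.
    + intros; apply exp_pos.
    + intros y Hy; replace (p y * (uj y - wj (S i) y)) with (p y * uj y - p y * wj (S i) y) by ring.
      apply (@is_derive_minus R_AbsRing R_NormedModule); [apply (esum_derive _ _ _ _ _ Hb)|auto].
    + intros y Hy; apply (@is_derive_minus R_AbsRing R_NormedModule); [|auto].
      apply (esum_flux_derive _ _ _ _ _ Hb); lra.
    + intros y Hy.
      assert (Hui : u y + h * us y = esum psi (euler_coef h i d) N y).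
      { unfold u, us, esum; rewrite scal_sum, <- plus_sum; apply sum_eq; intros k _.
        unfold euler_coef; simpl.
        assert (0 < lam k * h) by (apply Rmult_lt_0_compat; auto).
        field; lra. }
      specialize (H3 i y Hy); specialize (IH ltac:(lia) y ltac:(lra)).
      replace (u y - w (S i) y - h / 2 * p y * (- 2 * m y * us y - dwj (S i) y))
        with (u y + h * (p y * m y) * us y - (w (S i) y - h / 2 * p y * dwj (S i) y)) by field.
      rewrite exp_gamma_mult, Rmult_1_r; lra.
    + unfold u; rewrite (esum_zero _ _ _ _ _ Hb); specialize (H5 (S i) Hi); lra.
    + specialize (H6 (S i) Hi); unfold u; lra.
Qed.

(** With [n + 1] steps of length [t / (n + 1)] each of the finitely many coefficients converges to
    its exponential, so a bound uniform in [n] passes to the evolution. *)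
Lemma euler_limit_lower_bound N d t x B : 0 < t ->
  (forall n, B <= esum psi (euler_coef (t / INR (S n)) (S n) d) N x) ->
  B <= esum psi (fun k => exp (- lam k * t) * d k) N x.
Proof.
  intros Ht H.
  apply (is_lim_seq_le (fun _ => B) (fun n => esum psi (euler_coef (t / INR (S n)) (S n) d) N x)
    B (esum psi (fun k => exp (- lam k * t) * d k) N x) H); [apply is_lim_seq_const|].
  apply is_lim_seq_sum; intros k; unfold euler_coef.
  apply (is_lim_seq_mult' _ (fun _ => psi k x)); [|apply is_lim_seq_const].
  apply (is_lim_seq_mult' _ (fun _ => d k)); [|apply is_lim_seq_const].
  replace (- lam k * t) with (- (lam k * t)) by ring.
  eapply is_lim_seq_ext; [|apply euler_exp_lim, Rmult_lt_0_compat; auto].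
  intros n; unfold Rdiv; now rewrite Rmult_assoc.
Qed.

Lemma psi_bounds : exists B : nat -> R, forall k x, 0 <= x -> Rabs (psi k x) <= B k.
Proof.
  exists (fun k => proj1_sig (constructive_indefinite_description _
    (eig_bounded _ _ _ _ (eb_eig _ _ _ _ _ Hb k)))).
  intros k; exact (proj2_sig (constructive_indefinite_description _
    (eig_bounded _ _ _ _ (eb_eig _ _ _ _ _ Hb k)))).
Qed.

(** [1 + Lam] is a stationary supersolution that tends to infinity. *)
Lemma evolve_lower_bound N d del t : 0 < del -> 0 < t ->
  (forall x, 0 <= x -> - del * (1 + Lam x) <= esum psi d N x) ->
  forall x, 0 <= x -> - del * (1 + Lam x) <= esum psi (fun k => exp (- lam k * t) * d k) N x.
Proof.
  intros Hdel Ht H x Hx.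
  apply euler_limit_lower_bound; auto; intros n.
  set (h := t / INR (S n)).
  assert (Hh : 0 < h) by (apply Rdiv_lt_0_compat; auto; apply lt_0_INR; lia).
  destruct psi_bounds as [B HB].
  (* Euler factors are at most 1, so this sum bounds every iterate; where [del Lam] exceeds it, the
     right boundary condition holds at all steps. *)
  destruct (scale_unbounded _ _ _ _ Hd (sum_f_R0 (fun k => Rabs (d k) * B k) N / del)) as [Y [HY HY']].
  set (X := Rmax (x + 1) Y).
  assert (HX : x + 1 <= X) by apply Rmax_l.
  specialize (HY' X (Rmax_r _ _)).
  apply (euler_comparison N d h X (S n) (fun _ x => - del * (1 + Lam x)) (fun _ _ => - del) (fun _ _ => 0));
    auto; try lra.
  - intros _ y Hy; evar_last.
    + apply @is_derive_scal, (@is_derive_plus R_AbsRing R_NormedModule); [apply @is_derive_const|].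
      apply (scale_derive _ _ _ _ Hd).
    + unfold plus, zero; simpl; ring.
  - intros; apply @is_derive_const.
  - intros; lra.
  - intros; apply H; lra.
  - intros; rewrite scale_0; lra.
  - intros i _.
    assert (Hu : Rabs (esum psi (euler_coef h i d) N X) <= sum_f_R0 (fun k => Rabs (d k) * B k) N).
    { apply Rle_trans with (sum_f_R0 (fun k => Rabs (euler_coef h i d k) * B k) N).
      - apply esum_abs_le; intros; apply HB; lra.
      - apply sum_Rle; intros k _; unfold euler_coef; rewrite Rabs_mult.
        destruct (euler_factor_pow h k i Hh); rewrite Rabs_pos_eq by lra.
        apply Rmult_le_compat_r; [apply Rle_trans with (2 := HB k 0 (Rle_refl _)), Rabs_pos|].
        pose proof (Rabs_pos (d k)); nra. }
    apply Rabs_le_between in Hu.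
    apply (Rmult_le_compat_l del) in HY'; [|lra].
    replace (del * (sum_f_R0 (fun k => Rabs (d k) * B k) N / del)) with
      (sum_f_R0 (fun k => Rabs (d k) * B k) N) in HY' by (field; lra).
    lra.
Qed.

(** * Resolvents of nonnegative test functions *)

Section Test_function.

Variables (g : R -> R) (a b nf : R).
Hypothesis Ha : 0 < a.
Hypothesis Hab : a < b.
Hypothesis Hgc : cont g.
Hypothesis Hg0 : forall x, x < a \/ b < x -> g x = 0.
Hypothesis Hgpos : forall x, 0 <= g x.

Local Notation c := (fun k => RInt (fun x => g x * psi k x * (2 * m x)) a b).

Hypothesis Hnf : RInt (fun x => g x ^ 2 * (2 * m x)) a b = nf.
Hypothesis Hparseval : infinite_sum (fun k => c k ^ 2) nf.
Hint Resolve Hgc : cont_db.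

(** In the expanded square the term in [g] is [nf], the cross term is exactly the sum of [c_k^2],
    and Bessel bounds the last one on the truncated interval. *)
Lemma l2_error N X : b <= X ->
  RInt (fun x => (g x - esum psi c N x) ^ 2 * (2 * m x)) 0 X <= nf - sum_f_R0 (fun k => c k ^ 2) N.
Proof.
  intros HX.
  rewrite (RInt_ext_all _ (fun x => (g x ^ 2 * (2 * m x) + -2 * (g x * esum psi c N x * (2 * m x)))
    + esum psi c N x ^ 2 * (2 * m x))) by (intros; ring).
  rewrite RInt_plus_cont by ctac; rewrite RInt_plus_cont by ctac.
  rewrite (RInt_scal_cont (fun x => g x * esum psi c N x * (2 * m x))) by ctac.
  rewrite (RInt_support (fun x => g x ^ 2 * (2 * m x)) a b X), Hnf;
    [|ctac|lra|lra|lra|intros x Hx; rewrite Hg0 by auto; ring].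
  rewrite (RInt_support (fun x => g x * esum psi c N x * (2 * m x)) a b X);
    [|ctac|lra|lra|lra|intros x Hx; rewrite Hg0 by auto; ring].
  replace (RInt (fun x => g x * esum psi c N x * (2 * m x)) a b) with (sum_f_R0 (fun k => c k ^ 2) N).
  - pose proof (esum_bessel _ _ _ _ _ _ _ _ Hd Hb c N X ltac:(lra)); lra.
  - symmetry; rewrite (RInt_ext_all _ (fun x => sum_f_R0 (fun k => c k * (g x * psi k x * (2 * m x))) N)).
    + rewrite (RInt_sum (fun k x => c k * (g x * psi k x * (2 * m x)))) by (intros; ctac).
      apply sum_eq; intros k _.
      rewrite (RInt_scal_cont (fun x => g x * psi k x * (2 * m x))) by ctac; ring.
    + intros x; unfold esum.
      replace (g x * sum_f_R0 (fun k => c k * psi k x) N * (2 * m x)) with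
        (g x * (2 * m x) * sum_f_R0 (fun k => c k * psi k x) N) by ring.
      rewrite scal_sum; apply sum_eq; intros; ring.
Qed.

Lemma speed_integral X : 0 <= X -> RInt (fun x => 2 * m x) 0 X <= 2 * G0.
Proof.
  intros HX; rewrite (RInt_scal_cont (fun x => m x)) by ctac.
  pose proof (tail_nonneg _ _ _ _ Hd X HX); unfold tail in *; lra.
Qed.

(** The L2-error [e] of the partial sum is absorbed by the supersolution [E / h] with [L E = - |e|]. *)
Lemma resolvent_lower_bound h eps : 0 < h -> 0 < eps ->
  exists N0, forall N, (N0 <= N)%nat -> forall x, 0 <= x ->
    - eps * (1 + Lam x) <= esum psi (fun k => c k / (1 + lam k * h)) N x.
Proof.
  intros Hh Heps.
  pose proof (speed_integral 0 (Rle_refl _)) as HG0; rewrite RInt_point0 in HG0.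
  (* Cauchy-Schwarz will bound the L1-error by [sqrt (eta (2 G0 + 1)) = eps h / 2]; the [+ 1] keeps
     the denominator positive. *)
  set (eta := (eps * h / 2) ^ 2 / (2 * G0 + 1)).
  assert (Heh : 0 < eps * h / 2) by (apply Rdiv_lt_0_compat; [apply Rmult_lt_0_compat; lra|lra]).
  assert (Heta : 0 < eta) by (apply Rdiv_lt_0_compat; [apply pow_lt|]; lra).
  destruct (Hparseval eta Heta) as [N0 HN0].
  exists N0; intros N HN x Hx.
  specialize (HN0 N HN); unfold R_dist in HN0; rewrite Rabs_minus_sym in HN0.
  assert (Herr : nf - sum_f_R0 (fun k => c k ^ 2) N <= eta).
  { eapply Rle_trans; [apply Rle_abs|lra]. }
  set (e := fun x => g x - esum psi c N x).
  assert (Hec : cont e) by (unfold e; ctac).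
  destruct psi_bounds as [B HB].
  set (D := fun k => c k / (1 + lam k * h)).
  set (del := eps / 2).
  destruct (scale_unbounded _ _ _ _ Hd (sum_f_R0 (fun k => Rabs (D k) * B k) N / del)) as [Y [HY HY']].
  set (X := Rmax (x + 1) (Rmax b Y)).
  assert (HX1 : x + 1 <= X) by apply Rmax_l.
  assert (HX2 : b <= X) by (eapply Rle_trans; [apply Rmax_l|apply Rmax_r]).
  specialize (HY' X ltac:(eapply Rle_trans; [apply Rmax_r|apply Rmax_r])).
  set (T := RInt (fun z => Rabs (e z) * (2 * m z)) 0 X).
  (* [j] is the flux of [E]: it decreases from [T] to 0 at rate [2 m |e|], so that
     [L E = p j' / 2 = - |e|], and [0 <= j <= T] gives [0 <= E <= T Lam]. *)
  set (j := fun y => T - RInt (fun z => Rabs (e z) * (2 * m z)) 0 y).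
  set (E := fun y => RInt (fun z => p z * j z) 0 y).
  assert (HT : T <= eps * h / 2).
  { apply Rsqr_incr_0_var; [|lra].
    rewrite !Rsqr_pow2; unfold T.
    rewrite (RInt_ext_all _ (fun z => Rabs (e z) * 1 * (2 * m z))) by (intros; ring).
    eapply Rle_trans; [apply RInt_cauchy_schwarz; try ctac; [lra|]|].
    { intros z _; pose proof (exp_pos (- gamma z)); lra. }
    rewrite (RInt_ext_all _ (fun z => (g z - esum psi c N z) ^ 2 * (2 * m z))) by (intros; rewrite pow2_abs; reflexivity).
    rewrite (RInt_ext_all (fun z => 1 ^ 2 * (2 * m z)) (fun z => 2 * m z)) by (intros; ring).
    apply Rle_trans with (eta * (2 * G0 + 1)).
    - apply Rmult_le_compat.
      + apply RInt_nonneg; [lra|ctac|]; intros z _; apply Rmult_le_pos; [apply pow2_ge_0|].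
        pose proof (exp_pos (- gamma z)); lra.
      + apply RInt_nonneg; [lra|ctac|]; intros z _; pose proof (exp_pos (- gamma z)); lra.
      + apply Rle_trans with (2 := Herr), l2_error, HX2.
      + pose proof (speed_integral X ltac:(lra)); lra.
    - right; unfold eta; field; lra. }
  assert (Hjc : cont j).
  { unfold j; apply cont_minus; [ctac|].
    apply (cont_RInt (fun z => Rabs (e z) * (2 * m z))); ctac. }
  assert (Hj : forall y, 0 <= y <= X -> 0 <= j y <= T).
  { intros y Hy; unfold j, T; split.
    - enough (RInt (fun z => Rabs (e z) * (2 * m z)) 0 y <= RInt (fun z => Rabs (e z) * (2 * m z)) 0 X) by lra.
      apply RInt_nonneg_mono; [lra|ctac|]; intros z _; apply Rmult_le_pos; [apply Rabs_pos|].
      pose proof (exp_pos (- gamma z)); lra.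
    - enough (0 <= RInt (fun z => Rabs (e z) * (2 * m z)) 0 y) by lra.
      apply RInt_nonneg; [lra|ctac|]; intros z _; apply Rmult_le_pos; [apply Rabs_pos|].
      pose proof (exp_pos (- gamma z)); lra. }
  assert (HE : forall y, 0 <= y <= X -> 0 <= E y <= T * Lam y).
  { intros y Hy; unfold E, scale; split.
    - apply RInt_nonneg; [lra|ctac|]; intros z Hz; apply Rmult_le_pos; [left; apply exp_pos|apply Hj; lra].
    - rewrite <- (RInt_scal_cont (fun y => p y)) by ctac.
      apply RInt_le_cont; [lra|ctac|ctac|]; intros z Hz.
      rewrite Rmult_comm; apply Rmult_le_compat_r; [left; apply exp_pos|apply Hj; lra]. }
  assert (Hfin : 0 <= esum psi D N x + (/ h * E x + del * Lam x)).
  { apply (resolvent_max_principle (fun x => p x)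
      (fun x => esum psi D N x + (/ h * E x + del * Lam x))
      (fun x => esum J D N x + (/ h * j x + del))
      (fun x => - 2 * m x * esum psi (fun k => lam k * D k) N x + / h * - (Rabs (e x) * (2 * m x))) h X);
      auto; try lra.
    - intros; apply exp_pos.
    - intros y Hy; replace (p y * (esum J D N y + (/ h * j y + del))) with
        (p y * esum J D N y + (/ h * (p y * j y) + del * p y)) by ring.
      apply (@is_derive_plus R_AbsRing R_NormedModule); [apply (esum_derive _ _ _ _ _ Hb)|].
      apply (@is_derive_plus R_AbsRing R_NormedModule); apply @is_derive_scal.
      + apply (is_derive_RInt_cont (fun z => p z * j z)); ctac.
      + apply (scale_derive _ _ _ _ Hd).
    - intros y Hy.
      apply (@is_derive_plus R_AbsRing R_NormedModule); [apply (esum_flux_derive _ _ _ _ _ Hb); lra|].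
      evar_last.
      + apply (@is_derive_plus R_AbsRing R_NormedModule); [|apply @is_derive_const].
        apply @is_derive_scal, (@is_derive_minus R_AbsRing R_NormedModule); [apply @is_derive_const|].
        apply (is_derive_RInt_cont (fun z => Rabs (e z) * (2 * m z))); ctac.
      + unfold plus, minus, opp, zero; simpl; unfold plus; simpl; ring.
    - intros y Hy.
      (* Applying [1 - h L] to the candidate gives [esum psi c N + |e|] plus nonnegative terms, and
         [esum psi c N + |e| >= g >= 0]. *)
      set (us := esum psi (fun k => lam k * D k) N y).
      assert (Hui : esum psi D N y + h * us = esum psi c N y).
      { unfold us, esum; rewrite scal_sum, <- plus_sum; apply sum_eq; intros k _; unfold D.
        assert (0 < lam k * h) by (apply Rmult_lt_0_compat; auto); field; lra. }
      replace (esum psi D N y + (/ h * E y + del * Lam y)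
         - h / 2 * p y * (- 2 * m y * us + / h * - (Rabs (e y) * (2 * m y))))
        with (esum psi D N y + h * us * (p y * m y) + (/ h * E y + del * Lam y) + Rabs (e y) * (p y * m y))
        by (field; lra).
      rewrite exp_gamma_mult, !Rmult_1_r, Hui.
      destruct (HE y ltac:(lra)) as [HE0 _].
      assert (0 <= / h * E y) by (apply Rmult_le_pos; [left; apply Rinv_0_lt_compat|]; lra).
      assert (0 <= del * Lam y).
      { apply Rmult_le_pos; [unfold del; lra|apply (scale_nonneg _ _ _ _ Hd); lra]. }
      pose proof (Rle_abs (e y)); pose proof (Hgpos y); unfold e in *; lra.
    - rewrite (esum_zero _ _ _ _ _ Hb), scale_0; destruct (HE 0 ltac:(lra)) as [HE0 _].
      assert (0 <= / h * E 0) by (apply Rmult_le_pos; [left; apply Rinv_0_lt_compat|]; lra); lra.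
    - destruct (HE X ltac:(lra)) as [HE0 _].
      assert (0 <= / h * E X) by (apply Rmult_le_pos; [left; apply Rinv_0_lt_compat|]; lra).
      assert (Hu : Rabs (esum psi D N X) <= sum_f_R0 (fun k => Rabs (D k) * B k) N)
        by (apply esum_abs_le; intros; apply HB; lra).
      apply Rabs_le_between in Hu.
      apply (Rmult_le_compat_l del) in HY'; [|unfold del; lra].
      replace (del * (sum_f_R0 (fun k => Rabs (D k) * B k) N / del)) with
        (sum_f_R0 (fun k => Rabs (D k) * B k) N) in HY' by (field; unfold del; lra).
      lra. }
  destruct (HE x ltac:(lra)) as [_ HE1].
  pose proof (scale_nonneg _ _ _ _ Hd x Hx) as HL0.
  assert (/ h * E x <= / h * (eps * h / 2 * Lam x)).
  { apply Rmult_le_compat_l; [left; apply Rinv_0_lt_compat; lra|].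
    apply Rle_trans with (1 := HE1); apply Rmult_le_compat_r; lra. }
  replace (/ h * (eps * h / 2 * Lam x)) with (eps / 2 * Lam x) in H by (field; lra).
  unfold del in Hfin; lra.
Qed.

(** An error of the form [eps (1 + Lam)] is what the resolvent produces and what the evolution
    preserves, so the two bounds chain. *)
Lemma evolved_resolvent_lower_bound h eps t : 0 < h -> 0 < eps -> 0 < t ->
  exists N0, forall N, (N0 <= N)%nat -> forall x, 0 <= x ->
    - eps * (1 + Lam x) <= esum psi (fun k => exp (- lam k * t) * (c k / (1 + lam k * h))) N x.
Proof.
  intros Hh Heps Ht; destruct (resolvent_lower_bound h eps Hh Heps) as [N0 HN0].
  exists N0; intros N HN; apply (evolve_lower_bound N (fun k => c k / (1 + lam k * h))); auto.
Qed.

End Test_function.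

End Comparison.

(** * The kernel started from infinity *)

Lemma sum_geom_le (u : nat -> R) C rho N : 0 <= rho < 1 -> 0 <= C ->
  (forall k, u k <= C * rho ^ k) -> sum_f_R0 u N <= C / (1 - rho).
Proof.
  intros Hr HC Hu.
  apply Rle_trans with (C / (1 - rho) * (1 - rho ^ S N)).
  - induction N as [|N IH].
    + simpl; specialize (Hu 0%nat); simpl in Hu.
      replace (C / (1 - rho) * (1 - rho * 1)) with C by (field; lra); lra.
    + rewrite tech5; specialize (Hu (S N)).
      replace (C / (1 - rho) * (1 - rho ^ S (S N))) with
        (C / (1 - rho) * (1 - rho ^ S N) + C * rho ^ S N) by (simpl; field; lra); lra.
  - assert (0 <= rho ^ S N) by (apply pow_le; lra).
    assert (0 <= C / (1 - rho)) by (apply Rdiv_le_0_compat; lra); nra.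
Qed.

(** The explicit remainder does not depend on the terms beyond their geometric bound; applied to the
    kernel it is uniform in [x], so a sign of the full sum passes to partial sums up to a small
    constant. *)
Lemma infinite_sum_geom (u : nat -> R) C rho : 0 <= rho < 1 -> 0 <= C ->
  (forall k, Rabs (u k) <= C * rho ^ k) ->
  exists l, infinite_sum u l /\
    forall N, Rabs (l - sum_f_R0 u N) <= C / (1 - rho) * rho ^ S N.
Proof.
  intros Hr HC Hu.
  assert (Hex : ex_series u).
  { apply (ex_series_le (V := R_CompleteNormedModule) u (fun k => C * rho ^ k)); [exact Hu|].
    apply (ex_series_scal (V := R_NormedModule) C), ex_series_geom; rewrite Rabs_pos_eq; lra. }
  destruct Hex as [l Hl]; apply is_series_Reals in Hl.
  exists l; split; [exact Hl|]; intros N.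
  assert (HNn : forall j, Rabs (sum_f_R0 u (N + j) - sum_f_R0 u N) <=
    C / (1 - rho) * (rho ^ S N - rho ^ S (N + j))).
  { induction j as [|j IH].
    - rewrite Nat.add_0_r, Rminus_diag, Rabs_R0; lra.
    - rewrite Nat.add_succ_r, tech5.
      replace (sum_f_R0 u (N + j) + u (S (N + j)) - sum_f_R0 u N) with
        (sum_f_R0 u (N + j) - sum_f_R0 u N + u (S (N + j))) by ring.
      eapply Rle_trans; [apply Rabs_triang|].
      replace (C / (1 - rho) * (rho ^ S N - rho ^ S (S (N + j)))) with
        (C / (1 - rho) * (rho ^ S N - rho ^ S (N + j)) + C * rho ^ S (N + j)) by (simpl; field; lra).
      specialize (Hu (S (N + j))); lra. }
  apply le_epsilon; intros eps Heps.
  destruct (Hl eps Heps) as [n Hn]; specialize (Hn (N + n)%nat ltac:(lia)); unfold R_dist in Hn.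
  rewrite Rabs_minus_sym in Hn.
  replace (l - sum_f_R0 u N) with ((l - sum_f_R0 u (N + n)) + (sum_f_R0 u (N + n) - sum_f_R0 u N)) by ring.
  eapply Rle_trans; [apply Rabs_triang|].
  specialize (HNn n).
  assert (0 <= C / (1 - rho) * rho ^ S (N + n)).
  { apply Rmult_le_pos; [apply Rdiv_le_0_compat; lra|apply pow_le; lra]. }
  lra.
Qed.

Lemma infinite_sum_ge (u : nat -> R) l B : infinite_sum u l ->
  (forall eps, 0 < eps -> exists N0, forall N, (N0 <= N)%nat -> B - eps <= sum_f_R0 u N) -> B <= l.
Proof.
  intros Hl H; apply le_epsilon; intros eps Heps.
  destruct (Hl (eps / 2)) as [N1 HN1]; [lra|].
  destruct (H (eps / 2)) as [N0 HN0]; [lra|].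
  specialize (HN1 (N0 + N1)%nat ltac:(lia)); specialize (HN0 (N0 + N1)%nat ltac:(lia)).
  unfold R_dist in HN1; apply Rabs_def2 in HN1; lra.
Qed.

Lemma geom_tail_small A rho eps : 0 <= rho < 1 -> 0 < eps ->
  exists N0, forall N, (N0 <= N)%nat -> A * rho ^ S N <= eps.
Proof.
  intros Hr Heps.
  assert (H1 : 0 < Rabs A + 1) by (pose proof (Rabs_pos A); lra).
  destruct (pow_lt_1_zero rho ltac:(rewrite Rabs_pos_eq; lra) (eps / (Rabs A + 1))) as [N0 HN0].
  { apply Rdiv_lt_0_compat; lra. }
  exists N0; intros N HN; specialize (HN0 (S N) ltac:(lia)).
  assert (0 <= rho ^ S N) by (apply pow_le; lra); rewrite Rabs_pos_eq in HN0 by lra.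
  apply (Rmult_lt_compat_l (Rabs A + 1)) in HN0; [|lra].
  replace ((Rabs A + 1) * (eps / (Rabs A + 1))) with eps in HN0 by (field; lra).
  pose proof (Rle_abs A); nra.
Qed.

Lemma is_lim_dist_le (f : R -> R) (l v B X : R) : is_lim f p_infty l ->
  (forall x, X <= x -> Rabs (f x - v) <= B) -> Rabs (l - v) <= B.
Proof.
  intros Hl H; apply Rabs_le; split.
  - enough (v - B <= l) by lra.
    apply (is_lim_infty_ge f l (v - B) X Hl); intros x Hx.
    specialize (H x Hx); apply Rabs_le_between in H; lra.
  - enough (l <= v + B) by lra.
    apply (is_lim_infty_le f l (v + B) X Hl); intros x Hx.
    specialize (H x Hx); apply Rabs_le_between in H; lra.
Qed.

Lemma cont_bounded f X : cont f -> 0 <= X -> exists B, 0 < B /\ forall x, 0 <= x <= X -> Rabs (f x) <= B.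
Proof.
  intros Hf HX; destruct (continuity_ab_maj (fun x => Rabs (f x)) 0 X HX) as [y [Hy _]].
  - intros c _; apply continuity_pt_filterlim, (cont_abs f Hf).
  - exists (Rabs (f y) + 1); split; [pose proof (Rabs_pos (f y)); lra|].
    intros x Hx; specialize (Hy x Hx); lra.
Qed.

Lemma weighted_average_dist g f w a b v B : a < b -> cont g -> cont f -> cont w ->
  (forall x, 0 <= g x * w x) -> RInt (fun x => g x * w x) a b = 1 ->
  (forall x, a < x < b -> Rabs (f x - v) <= B) ->
  Rabs (RInt (fun x => g x * f x * w x) a b - v) <= B.
Proof.
  intros Hab Hg Hf Hw Hpos H1 HB.
  assert (Hgen : forall s, s * RInt (fun x => g x * w x) a b = RInt (fun x => s * (g x * w x)) a b).
  { intros s; rewrite (RInt_scal_cont (fun x => g x * w x)) by ctac; reflexivity. }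
  assert (Hlo : (v - B) * RInt (fun x => g x * w x) a b <= RInt (fun x => g x * f x * w x) a b).
  { rewrite Hgen; apply RInt_le_cont; [lra|ctac|ctac|]; intros x Hx.
    specialize (HB x Hx); specialize (Hpos x); apply Rabs_le_between in HB; nra. }
  assert (Hup : RInt (fun x => g x * f x * w x) a b <= (v + B) * RInt (fun x => g x * w x) a b).
  { rewrite Hgen; apply RInt_le_cont; [lra|ctac|ctac|]; intros x Hx.
    specialize (HB x Hx); specialize (Hpos x); apply Rabs_le_between in HB; nra. }
  rewrite H1 in *; apply Rabs_le; lra.
Qed.

Section Kernel.

Variables (q gamma : R -> R) (G0 L : R) (lam : nat -> R) (psi J : nat -> R -> R) (pinf : nat -> R).
Hypothesis Hd : diffusion q gamma G0 L.
Hypothesis Hb : eigenbasis gamma lam psi J pinf.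

Local Notation p x := (exp (gamma x)).
Local Notation m x := (exp (- gamma x)).
Local Notation Lam := (scale gamma).
Local Notation G := (tail gamma G0).
Local Notation Ent := (entrance gamma G0).

Let Hg : cont gamma := gamma_cont _ _ _ _ Hd.
Let HLam : cont Lam := scale_cont _ _ _ _ Hd.
Let HG : cont G := tail_cont _ _ _ _ Hd.
Let Hpsi : forall k, cont (psi k) := psi_cont _ _ _ _ _ Hb.
Let HJ : forall k, cont (J k) := J_cont _ _ _ _ _ Hb.
Let Hes : forall c N, cont (esum psi c N) := esum_psi_cont _ _ _ _ _ Hb.
Let Hlam : forall k, 0 < lam k := lam_pos _ _ _ _ _ Hb.
Hint Resolve Hg HLam HG Hpsi HJ Hes : cont_db.

(** If the limit were 0, then beyond the point where [L - S <= 1 / (4 lam)] the increment bound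
    would halve any bound on [psi], hence [psi = 0] there. Flux and eigenfunction then vanish at
    [X], backward uniqueness extends this to [[0, X]], and the unit norm is contradicted. *)
Lemma psi_at_infinity_neq0 k : pinf k <> 0.
Proof.
  intros H0.
  assert (He := eb_eig _ _ _ _ _ Hb k).
  destruct (eig_bounded _ _ _ _ He) as [M HM].
  assert (HM0 : 0 <= M) by (apply Rle_trans with (2 := HM 0 (Rle_refl _)), Rabs_pos).
  pose proof (Hlam k) as Hk.
  destruct (entrance_lim _ _ _ _ Hd (/ (4 * lam k))) as [X [HX HX']].
  { apply Rinv_0_lt_compat; lra. }
  assert (Hn : forall n x, X <= x -> Rabs (psi k x) <= M * (/ 2) ^ n).
  { induction n as [|n IH]; intros x Hx.
    - simpl; rewrite Rmult_1_r; apply HM; lra.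
    - assert (Hinc := eigenfn_increment _ _ _ _ Hd _ _ _ X (M * (/ 2) ^ n) He HX IH).
      rewrite <- Rabs_Ropp.
      replace (- psi k x) with (pinf k - psi k x) by (rewrite H0; ring).
      apply (is_lim_dist_le (psi k) (pinf k) (psi k x) _ x (eb_lim _ _ _ _ _ Hb k)); intros y Hy.
      apply Rle_trans with (1 := Hinc x y ltac:(lra)).
      pose proof (entrance_le _ _ _ _ Hd y ltac:(lra)); specialize (HX' x Hx).
      assert (0 <= M * (/ 2) ^ n) by (apply Rmult_le_pos; [auto|apply pow_le; lra]).
      apply Rle_trans with (2 * lam k * (M * (/ 2) ^ n) * / (4 * lam k)).
      + apply Rmult_le_compat_l; [nra|lra].
      + right; simpl; field; lra. }
  assert (Hz : forall x, X <= x -> Rabs (psi k x) <= 0).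
  { intros x Hx; apply le_epsilon; intros eps Heps.
    destruct (geom_tail_small (2 * M) (/ 2) eps ltac:(lra) Heps) as [N HN].
    specialize (HN N (le_n _)); simpl in HN; specialize (Hn N x Hx).
    replace (2 * M * (/ 2 * (/ 2) ^ N)) with (M * (/ 2) ^ N) in HN by field; lra. }
  assert (HJz := flux_bound _ _ _ _ Hd _ _ _ X 0 He HX Hz X (Rle_refl _)).
  rewrite Rmult_0_r, Rmult_0_l in HJz.
  specialize (Hz X (Rle_refl _)) as HzX.
  (* Backward Gronwall: [psi^2 + J^2] has derivative [2 psi J (p - 2 lam m)], so multiplied by
     [exp (K x)] it is nondecreasing. *)
  destruct (cont_bounded (fun x => p x - 2 * lam k * m x) X ltac:(ctac) HX) as [K [HK HK']].
  assert (Hzero : forall x, 0 <= x <= X -> psi k x = 0).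
  { intros x Hx.
    assert (Hmono : (psi k x ^ 2 + J k x ^ 2) * exp (K * x) <= (psi k X ^ 2 + J k X ^ 2) * exp (K * X)).
    { apply (derive_nonneg_le (fun y => (psi k y ^ 2 + J k y ^ 2) * exp (K * y))
       (fun y => (2 * (psi k y * J k y) * (p y - 2 * lam k * m y) + K * (psi k y ^ 2 + J k y ^ 2)) * exp (K * y)));
       [lra| |]; intros y Hy.
      - assert (E1 := eig_derive _ _ _ _ He y); assert (E2 := flux_derive _ _ _ _ He y ltac:(lra)).
        auto_derive; [repeat split; auto; eexists; eauto|].
        derive_subst E1; derive_subst E2; ring.
      - apply Rmult_le_pos; [|left; apply exp_pos].
        specialize (HK' y ltac:(lra)); cbv beta in HK'; set (r := p y - 2 * lam k * m y) in *.
        apply Rabs_le_between in HK'.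
        assert (0 <= (psi k y + J k y) ^ 2) by apply pow2_ge_0.
        assert (0 <= (psi k y - J k y) ^ 2) by apply pow2_ge_0.
        replace (2 * (psi k y * J k y) * r + K * (psi k y ^ 2 + J k y ^ 2)) with
          ((K + r) * / 2 * (psi k y + J k y) ^ 2 + (K - r) * / 2 * (psi k y - J k y) ^ 2) by field.
        assert (0 <= (K + r) * / 2) by lra; assert (0 <= (K - r) * / 2) by lra.
        apply Rplus_le_le_0_compat; now apply Rmult_le_pos. }
    assert (psi k X = 0) by (destruct (Req_dec (psi k X) 0) as [|Hne]; auto; apply Rabs_pos_lt in Hne; lra).
    assert (J k X = 0) by (destruct (Req_dec (J k X) 0) as [|Hne]; auto; apply Rabs_pos_lt in Hne; lra).
    rewrite H, H1 in Hmono; pose proof (exp_pos (K * x)).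
    assert (psi k x ^ 2 + J k x ^ 2 <= 0).
    { apply (Rmult_le_reg_r (exp (K * x))); [auto|].
      replace ((0 ^ 2 + 0 ^ 2) * exp (K * X)) with 0 in Hmono by ring; lra. }
    pose proof (pow2_ge_0 (J k x)); pose proof (pow2_ge_0 (psi k x)); nra. }
  assert (Hall : forall x, 0 <= x -> psi k x = 0).
  { intros x Hx; destruct (Rle_lt_dec x X); [apply Hzero; lra|].
    specialize (Hz x ltac:(lra)).
    destruct (Req_dec (psi k x) 0) as [|Hne]; auto; apply Rabs_pos_lt in Hne; lra. }
  assert (Horth := eb_orth _ _ _ _ _ Hb k k).
  assert (H1 : kron k k <= 0).
  { apply (is_lim_infty_le _ _ 0 0 Horth); intros x Hx; right.
    rewrite (RInt_ext _ (fun _ => 0)).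
    - rewrite (RInt_const (V := R_CompleteNormedModule)); unfold scal; simpl; unfold mult; simpl; ring.
    - intros y; rewrite Rmin_left, Rmax_right by lra; intros Hy; rewrite (Hall y) by lra; rewrite !Rmult_0_l; reflexivity. }
  unfold kron in H1; destruct (Nat.eq_dec k k); [lra|lia].
Qed.

(** Budget of the decay [exp (- s lam)]: the sup-norms take [s lam / 4] and the polynomial weight
    another [s lam / 4]. The remaining [exp (- s lam / 2)] is geometric with ratio
    [exp (- s / (4 L))] by [eigenvalue_growth]. *)
Lemma eigen_weights s :
  (forall tau, 0 < tau -> exists C, 0 < C /\
    forall k x, 0 <= x -> psi k x ^ 2 <= C * exp (tau * lam k)) ->
  0 < s -> exists (M : nat -> R) C rho, 0 <= C /\ 0 <= rho < 1 /\
    (forall k x, 0 <= x -> Rabs (psi k x) <= M k) /\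
    (forall k, (1 + lam k) ^ 2 * M k ^ 2 * exp (- lam k * s) <= C * rho ^ k).
Proof.
  intros Hsup Hs.
  destruct (Hsup (s / 4) ltac:(lra)) as [C [HC HC']].
  assert (HLpos : 0 < L).
  { pose proof (eigenvalue_growth _ _ _ _ _ _ _ _ Hd Hb 0) as H.
    pose proof (Hlam 0); simpl in H; nra. }
  exists (fun k => sqrt (C * exp (s / 4 * lam k))), (C * (1 + 8 / s) ^ 2), (exp (- s / (4 * L))).
  assert (H8 : 0 < 8 / s) by (apply Rdiv_lt_0_compat; lra).
  repeat split.
  - apply Rmult_le_pos; [lra|apply pow2_ge_0].
  - left; apply exp_pos.
  - rewrite <- exp_0; apply exp_increasing.
    assert (0 < s / (4 * L)) by (apply Rdiv_lt_0_compat; lra).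
    replace (- s / (4 * L)) with (- (s / (4 * L))) by (field; lra); lra.
  - intros k x Hx.
    rewrite <- (sqrt_Rsqr_abs (psi k x)), Rsqr_pow2; apply sqrt_le_1_alt, HC', Hx.
  - intros k; pose proof (Hlam k) as Hk.
    rewrite pow2_sqrt by (apply Rmult_le_pos; [lra|left; apply exp_pos]).
    set (y := s * lam k / 8).
    assert (Hy : 0 < y) by (apply Rdiv_lt_0_compat; [apply Rmult_lt_0_compat; lra|lra]).
    assert (H1 : 1 + lam k <= (1 + 8 / s) * exp y).
    { apply Rle_trans with ((1 + 8 / s) * (1 + y)); [|apply Rmult_le_compat_l; [lra|apply exp_ineq1_le]].
      assert (8 / s * y = lam k) by (unfold y; field; lra); nra. }
    assert (H2 : (1 + lam k) ^ 2 <= (1 + 8 / s) ^ 2 * exp (2 * y)).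
    { replace (exp (2 * y)) with (exp y ^ 2) by (simpl; rewrite Rmult_1_r, <- exp_plus; f_equal; ring).
      rewrite <- Rpow_mult_distr; apply pow_incr; lra. }
    apply Rle_trans with ((1 + 8 / s) ^ 2 * exp (2 * y) * (C * exp (s / 4 * lam k)) * exp (- lam k * s)).
    { apply Rmult_le_compat_r; [left; apply exp_pos|].
      apply Rmult_le_compat_r; [apply Rmult_le_pos; [lra|left; apply exp_pos]|auto]. }
    replace ((1 + 8 / s) ^ 2 * exp (2 * y) * (C * exp (s / 4 * lam k)) * exp (- lam k * s)) with
      (C * (1 + 8 / s) ^ 2 * (exp (2 * y) * exp (s / 4 * lam k) * exp (- lam k * s))) by ring.
    rewrite <- !exp_plus.
    apply Rmult_le_compat_l; [apply Rmult_le_pos; [lra|apply pow2_ge_0]|].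
    rewrite exp_pow; apply exp_le.
    replace (2 * y + s / 4 * lam k + - lam k * s) with (- (s * lam k / 2)) by (unfold y; field).
    pose proof (eigenvalue_growth _ _ _ _ _ _ _ _ Hd Hb k) as Hgr; rewrite S_INR in Hgr.
    apply (Rmult_le_reg_r (4 * L / s)); [apply Rdiv_lt_0_compat; lra|].
    replace (- (s * lam k / 2) * (4 * L / s)) with (- (2 * L * lam k)) by (field; lra).
    replace (INR k * (- s / (4 * L)) * (4 * L / s)) with (- INR k) by (field; lra).
    lra.
Qed.

(** * Termwise domination and two-sided estimates of the kernel *)

Section Weights.

Variables (M : nat -> R) (C rho s : R).
Hypothesis HC : 0 <= C.
Hypothesis Hrho : 0 <= rho < 1.
Hypothesis Hs : 0 < s.
Hypothesis HM : forall k x, 0 <= x -> Rabs (psi k x) <= M k.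
Hypothesis HW : forall k, (1 + lam k) ^ 2 * M k ^ 2 * exp (- lam k * s) <= C * rho ^ k.

Lemma M_nonneg k : 0 <= M k.
Proof. apply Rle_trans with (2 := HM k 0 (Rle_refl _)), Rabs_pos. Qed.

Lemma pinf_le k : Rabs (pinf k) <= M k.
Proof.
  rewrite <- (Rminus_0_r (pinf k)).
  apply (is_lim_dist_le (psi k) (pinf k) 0 _ 0 (eb_lim _ _ _ _ _ Hb k)); intros x Hx.
  rewrite Rminus_0_r; auto.
Qed.

Lemma psi_le_entrance k x : 0 <= x -> Rabs (psi k x) <= 2 * lam k * M k * Ent x.
Proof.
  intros Hx.
  assert (H := eigenfn_increment _ _ _ _ Hd _ _ _ 0 (M k) (eb_eig _ _ _ _ _ Hb k) (Rle_refl _) (HM k) 0 x ltac:(lra)).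
  rewrite (eig_zero _ _ _ _ (eb_eig _ _ _ _ _ Hb k)), entrance_0, !Rminus_0_r in H; auto.
Qed.

Lemma pinf_dist k x : 0 <= x -> Rabs (pinf k - psi k x) <= 2 * lam k * M k * (L - Ent x).
Proof.
  intros Hx.
  apply (is_lim_dist_le (psi k) (pinf k) (psi k x) _ x (eb_lim _ _ _ _ _ Hb k)); intros y Hy.
  eapply Rle_trans.
  - apply (eigenfn_increment _ _ _ _ Hd _ _ _ 0 (M k) (eb_eig _ _ _ _ _ Hb k) (Rle_refl _) (HM k)); lra.
  - apply Rmult_le_compat_l.
    + pose proof (Hlam k); pose proof (M_nonneg k); apply Rmult_le_pos; lra.
    + pose proof (entrance_le _ _ _ _ Hd y ltac:(lra)); lra.
Qed.

(** Used with [r] equal to 1, [lam] or [lam^2], according to how many of the two eigenfunction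
    factors are estimated through increments. *)
Lemma weight_le k r : r <= (1 + lam k) ^ 2 -> r * M k ^ 2 * exp (- lam k * s) <= C * rho ^ k.
Proof.
  intros Hr; apply Rle_trans with (2 := HW k).
  apply Rmult_le_compat_r; [left; apply exp_pos|].
  apply Rmult_le_compat_r; [apply pow2_ge_0|auto].
Qed.

Lemma exp_time_le k t : s <= t -> exp (- lam k * t) <= exp (- lam k * s).
Proof. intros Ht; apply exp_le; pose proof (Hlam k); nra. Qed.

Lemma kernel_term_le k t a b c : s <= t -> 0 <= c <= (1 + lam k) ^ 2 ->
  Rabs a * Rabs b <= c * M k ^ 2 -> Rabs (exp (- lam k * t) * a * b) <= C * rho ^ k.
Proof.
  intros Ht Hc H; rewrite !Rabs_mult, (Rabs_pos_eq (exp _)) by (left; apply exp_pos).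
  apply Rle_trans with (exp (- lam k * s) * (Rabs a * Rabs b)).
  - rewrite Rmult_assoc; apply Rmult_le_compat_r; [|now apply exp_time_le].
    apply Rmult_le_pos; apply Rabs_pos.
  - apply Rle_trans with (2 := weight_le k c (proj2 Hc)).
    rewrite Rmult_comm; apply Rmult_le_compat_r; [left; apply exp_pos|auto].
Qed.

Lemma kernel_inf_term k t x : s <= t -> 0 <= x ->
  Rabs (exp (- lam k * t) * pinf k * psi k x) <= C * rho ^ k.
Proof.
  intros Ht Hx; pose proof (Hlam k); apply kernel_term_le with 1; auto; [nra|].
  pose proof (pinf_le k); pose proof (HM k x Hx); pose proof (Rabs_pos (pinf k)); pose proof (Rabs_pos (psi k x)).
  simpl; rewrite Rmult_1_l, Rmult_1_r; apply Rmult_le_compat; auto.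
Qed.

Lemma kernel_fin_term k t z x : s <= t -> 0 <= z -> 0 <= x ->
  Rabs (exp (- lam k * t) * psi k z * psi k x) <= C * rho ^ k.
Proof.
  intros Ht Hz Hx; pose proof (Hlam k); apply kernel_term_le with 1; auto; [nra|].
  simpl; rewrite Rmult_1_l, Rmult_1_r; apply Rmult_le_compat; auto using Rabs_pos.
Qed.

(** Each term is [exp (- lam t) (pinf - psi z) (psi x)]; the increments from [z] to infinity and
    from 0 to [x] give the factors [L - Ent z] and [Ent x], with [4 = 2 * 2]. The factor [Ent x] is
    what later cancels against the lower bound. *)
Lemma kernel_difference t z x linf lfin : s <= t -> 0 <= z -> 0 <= x ->
  infinite_sum (fun k => exp (- lam k * t) * pinf k * psi k x) linf ->
  infinite_sum (fun k => exp (- lam k * t) * psi k z * psi k x) lfin ->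
  Rabs (linf - lfin) <= 4 * C / (1 - rho) * (Ent x * (L - Ent z)).
Proof.
  intros Ht Hz Hx Hinf Hfin.
  pose proof (entrance_nonneg _ _ _ _ Hd x Hx) as HS.
  pose proof (entrance_le _ _ _ _ Hd z Hz) as HLz.
  set (D := Ent x * (L - Ent z)).
  assert (HD : 0 <= D) by (apply Rmult_le_pos; lra).
  assert (HN : forall N, Rabs (sum_f_R0 (fun k => exp (- lam k * t) * pinf k * psi k x) N
    - sum_f_R0 (fun k => exp (- lam k * t) * psi k z * psi k x) N) <= 4 * C / (1 - rho) * D).
  { intros N; rewrite <- minus_sum.
    eapply Rle_trans; [apply Rsum_abs|].
    replace (4 * C / (1 - rho) * D) with (4 * C * D / (1 - rho)) by (field; lra).
    apply sum_geom_le; auto; [repeat apply Rmult_le_pos; lra|]; intros k.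
    replace (exp (- lam k * t) * pinf k * psi k x - exp (- lam k * t) * psi k z * psi k x) with
      (exp (- lam k * t) * (pinf k - psi k z) * psi k x) by ring.
    rewrite !Rabs_mult, (Rabs_pos_eq (exp _)) by (left; apply exp_pos).
    pose proof (psi_le_entrance k x Hx) as H1; pose proof (pinf_dist k z Hz) as H2.
    pose proof (exp_time_le k t Ht) as H3; pose proof (exp_pos (- lam k * t)) as H4.
    pose proof (Hlam k) as Hk.
    assert (H5 := weight_le k (lam k ^ 2) ltac:(nra)).
    apply Rle_trans with (exp (- lam k * s) * (2 * lam k * M k * (L - Ent z)) * (2 * lam k * M k * Ent x)).
    - apply Rmult_le_compat; [apply Rmult_le_pos; [lra|apply Rabs_pos]|apply Rabs_pos| |auto].
      apply Rmult_le_compat; [lra|apply Rabs_pos|auto|auto].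
    - replace (exp (- lam k * s) * (2 * lam k * M k * (L - Ent z)) * (2 * lam k * M k * Ent x)) with
        (4 * D * (lam k ^ 2 * M k ^ 2 * exp (- lam k * s))) by (unfold D; ring).
      replace (4 * C * D * rho ^ k) with (4 * D * (C * rho ^ k)) by ring.
      apply Rmult_le_compat_l; lra. }
  apply le_epsilon; intros eps Heps.
  destruct (Hinf (eps / 2) ltac:(lra)) as [N1 H1]; destruct (Hfin (eps / 2) ltac:(lra)) as [N2 H2].
  specialize (H1 (N1 + N2)%nat ltac:(lia)); specialize (H2 (N1 + N2)%nat ltac:(lia)).
  specialize (HN (N1 + N2)%nat); unfold R_dist in *.
  apply Rabs_def2 in H1; apply Rabs_def2 in H2; apply Rabs_le_between in HN.
  apply Rabs_le; lra.
Qed.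

(** The kernel from infinity is the limit, as [j -> oo] and [h -> 0], of the images under
    [P_s (1 - h L)^-1] of probability densities on [[j, j + 1]]. *)
Lemma kernel_inf_nonneg x l : 0 <= x ->
  infinite_sum (fun k => exp (- lam k * s) * pinf k * psi k x) l -> 0 <= l.
Proof.
  intros Hx Hl; apply (infinite_sum_ge _ l 0 Hl); intros eps Heps.
  pose proof (scale_nonneg _ _ _ _ Hd x Hx) as HLx.
  set (K := C / (1 - rho)).
  assert (HK : 0 <= K) by (apply Rdiv_le_0_compat; lra).
  (* Chosen so that the total error [2 h K] of the approximation below is at most [eps / 2]. *)
  set (h := eps / (4 * (K + 1))).
  assert (Hh : 0 < h) by (apply Rdiv_lt_0_compat; lra).
  (* This far out, replacing [pinf] by an average of [psi] costs at most [lam M h] per coefficient,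
     the same as the resolvent step. *)
  destruct (entrance_lim _ _ _ _ Hd (h / 2) ltac:(lra)) as [X [HX HX']].
  set (a := X + 1).
  specialize (HX' a ltac:(unfold a; lra)).
  set (T := fun y => Rmax 0 ((y - a) * (a + 1 - y))).
  assert (HTc : cont T) by (apply (cont_comp (fun u => Rmax 0 u)); [apply cont_Rmax0|ctac]).
  assert (Hmp : forall y, 0 < 2 * m y) by (intros; pose proof (exp_pos (- gamma y)); lra).
  set (kap := RInt (fun y => T y * (2 * m y)) a (a + 1)).
  assert (Hkap : 0 < kap).
  { apply RInt_gt_0; [lra| |].
    - intros y Hy; apply Rmult_lt_0_compat; auto.
      apply Rlt_le_trans with (2 := Rmax_r _ _); apply Rmult_lt_0_compat; lra.
    - intros y _; revert y; change (cont (fun y => T y * (2 * m y))); ctac. }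
  set (g := fun y => / kap * T y).
  assert (Hgc : cont g) by (unfold g; ctac).
  assert (Hgp : forall y, 0 <= g y).
  { intros; apply Rmult_le_pos; [left; now apply Rinv_0_lt_compat|apply Rmax_l]. }
  assert (Hg0 : forall y, y < a \/ a + 1 < y -> g y = 0).
  { intros y Hy; unfold g, T; rewrite Rmax_left; [apply Rmult_0_r|]; destruct Hy; nra. }
  assert (Hg1 : RInt (fun y => g y * (2 * m y)) a (a + 1) = 1).
  { rewrite (RInt_ext_all _ (fun y => / kap * (T y * (2 * m y)))) by (intros; unfold g; ring).
    rewrite (RInt_scal_cont (fun y => T y * (2 * m y))) by ctac.
    apply (Rinv_l kap); lra. }
  destruct (eb_complete _ _ _ _ _ Hb g a (a + 1)) as [nf [Hnf Hpars]]; [unfold a; lra|lra|auto|auto|].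
  set (c := fun k => RInt (fun y => g y * psi k y * (2 * m y)) a (a + 1)) in *.
  assert (Hc1 : forall k, Rabs (c k) <= M k).
  { intros k; rewrite <- (Rminus_0_r (c k)).
    apply (weighted_average_dist g (psi k) (fun y => 2 * m y)); auto; try lra; try ctac.
    - intros y; apply Rmult_le_pos; [auto|left; auto].
    - intros y Hy; rewrite Rminus_0_r; apply HM; unfold a in Hy; lra. }
  assert (Hc2 : forall k, Rabs (c k - pinf k) <= lam k * M k * h).
  { intros k; apply (weighted_average_dist g (psi k) (fun y => 2 * m y)); auto; try lra; try ctac.
    - intros y; apply Rmult_le_pos; [auto|left; auto].
    - intros y Hy; rewrite Rabs_minus_sym.
      apply Rle_trans with (1 := pinf_dist k y ltac:(unfold a in Hy; lra)).
      pose proof (entrance_mono _ _ _ _ Hd a y ltac:(unfold a in *; lra)).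
      pose proof (Hlam k); pose proof (M_nonneg k).
      replace (lam k * M k * h) with (2 * lam k * M k * (h / 2)) by field.
      apply Rmult_le_compat_l; [apply Rmult_le_pos; lra|lra]. }
  (* The point [x] is fixed, so the weight [1 + Lam x] can be divided out. *)
  set (e2 := eps / (2 * (1 + Lam x))).
  assert (He2 : 0 < e2) by (apply Rdiv_lt_0_compat; lra).
  destruct (evolved_resolvent_lower_bound q gamma G0 L lam psi J pinf Hd Hb g a (a + 1) nf
    ltac:(unfold a; lra) ltac:(lra) Hgc Hg0 Hgp Hnf Hpars h e2 s Hh He2 Hs) as [N0 HN0].
  exists N0; intros N HN; specialize (HN0 N HN x Hx).
  replace (- e2 * (1 + Lam x)) with (- (eps / 2)) in HN0 by (unfold e2; field; lra).
  change (- (eps / 2) <= esum psi (fun k => exp (- lam k * s) * (c k / (1 + lam k * h))) N x) in HN0.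
  assert (Hdiff : Rabs (esum psi (fun k => exp (- lam k * s) * (c k / (1 + lam k * h))) N x
    - sum_f_R0 (fun k => exp (- lam k * s) * pinf k * psi k x) N) <= 2 * h * K).
  { unfold esum; rewrite <- minus_sum.
    eapply Rle_trans; [apply Rsum_abs|].
    replace (2 * h * K) with (2 * h * C / (1 - rho)) by (unfold K; field; lra).
    apply sum_geom_le; auto; [apply Rmult_le_pos; lra|]; intros k.
    pose proof (Hlam k) as Hk; assert (Hkh : 0 < lam k * h) by (apply Rmult_lt_0_compat; auto).
    pose proof (M_nonneg k) as HMk.
    assert (H1 : Rabs (c k / (1 + lam k * h) - pinf k) <= 2 * h * (lam k * M k)).
    { replace (c k / (1 + lam k * h) - pinf k) with
        ((c k - pinf k) + - (c k * (lam k * h / (1 + lam k * h)))) by (field; lra).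
      eapply Rle_trans; [apply Rabs_triang|]; rewrite Rabs_Ropp, Rabs_mult.
      assert (H2 : 0 <= lam k * h / (1 + lam k * h) <= lam k * h).
      { split; [apply Rdiv_le_0_compat; lra|].
        apply (Rmult_le_reg_r (1 + lam k * h)); [lra|].
        replace (lam k * h / (1 + lam k * h) * (1 + lam k * h)) with (lam k * h) by (field; lra); nra. }
      rewrite (Rabs_pos_eq (lam k * h / _)) by lra.
      assert (Rabs (c k) * (lam k * h / (1 + lam k * h)) <= M k * (lam k * h)).
      { apply Rmult_le_compat; auto using Rabs_pos; lra. }
      specialize (Hc2 k); lra. }
    replace (exp (- lam k * s) * (c k / (1 + lam k * h)) * psi k x - exp (- lam k * s) * pinf k * psi k x)
      with (exp (- lam k * s) * ((c k / (1 + lam k * h) - pinf k) * psi k x)) by ring.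
    rewrite !Rabs_mult, (Rabs_pos_eq (exp _)) by (left; apply exp_pos).
    assert (H5 := weight_le k (lam k) ltac:(nra)).
    apply Rle_trans with (exp (- lam k * s) * (2 * h * (lam k * M k) * M k)).
    - apply Rmult_le_compat_l; [left; apply exp_pos|].
      apply Rmult_le_compat; auto using Rabs_pos.
    - replace (exp (- lam k * s) * (2 * h * (lam k * M k) * M k)) with
        (2 * h * (lam k * M k ^ 2 * exp (- lam k * s))) by ring.
      replace (2 * h * C * rho ^ k) with (2 * h * (C * rho ^ k)) by ring.
      apply Rmult_le_compat_l; lra. }
  assert (2 * h * K <= eps / 2).
  { unfold h; replace (2 * (eps / (4 * (K + 1))) * K) with (eps / 2 * (K / (K + 1))) by (field; lra).
    assert (K / (K + 1) <= 1).
    { apply (Rmult_le_reg_r (K + 1)); [lra|].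
      replace (K / (K + 1) * (K + 1)) with K by (field; lra); lra. }
    nra. }
  apply Rabs_le_between in Hdiff; lra.
Qed.

(** With [psi z] replaced by [pinf] the terms are nonnegative squares, of which only the first is
    kept; [pinf_dist] bounds the replacement. The factors [e] are general so that Euler iterates,
    and not only exponentials, are covered. *)
Lemma kernel_inf_far_lower_bound (e : nat -> R) N z : 0 <= z ->
  (forall k, 0 <= e k <= exp (- lam k * s)) ->
  e 0%nat * pinf 0%nat ^ 2 - 2 * C / (1 - rho) * (L - Ent z) <=
  sum_f_R0 (fun k => e k * pinf k * psi k z) N.
Proof.
  intros Hz He.
  pose proof (entrance_le _ _ _ _ Hd z Hz) as HLz.
  rewrite (sum_eq _ (fun k => e k * pinf k ^ 2 - e k * pinf k * (pinf k - psi k z))) by (intros; ring).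
  rewrite minus_sum.
  assert (H1 : e 0%nat * pinf 0%nat ^ 2 <= sum_f_R0 (fun k => e k * pinf k ^ 2) N).
  { assert (Hp : forall k, 0 <= e k * pinf k ^ 2) by (intros; apply Rmult_le_pos; [apply He|apply pow2_ge_0]).
    induction N as [|N IH]; [right; reflexivity|].
    rewrite tech5; specialize (Hp (S N)); lra. }
  assert (H2 : sum_f_R0 (fun k => e k * pinf k * (pinf k - psi k z)) N <= 2 * C / (1 - rho) * (L - Ent z)).
  { replace (2 * C / (1 - rho) * (L - Ent z)) with (2 * C * (L - Ent z) / (1 - rho)) by (field; lra).
    apply sum_geom_le; auto; [repeat apply Rmult_le_pos; lra|]; intros k.
    eapply Rle_trans; [apply Rle_abs|].
    destruct (He k) as [He0 He1]; rewrite !Rabs_mult, (Rabs_pos_eq (e k)) by auto.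
    pose proof (pinf_le k) as H2; pose proof (pinf_dist k z Hz) as H3; pose proof (Hlam k) as Hk.
    assert (H5 := weight_le k (lam k) ltac:(nra)).
    apply Rle_trans with (exp (- lam k * s) * M k * (2 * lam k * M k * (L - Ent z))).
    - apply Rmult_le_compat; auto using Rabs_pos; [apply Rmult_le_pos; auto using Rabs_pos|].
      apply Rmult_le_compat; auto using Rabs_pos.
    - replace (exp (- lam k * s) * M k * (2 * lam k * M k * (L - Ent z))) with
        (2 * (L - Ent z) * (lam k * M k ^ 2 * exp (- lam k * s))) by ring.
      replace (2 * C * (L - Ent z) * rho ^ k) with (2 * (L - Ent z) * (C * rho ^ k)) by ring.
      apply Rmult_le_compat_l; lra. }
  lra.
Qed.

(** On [[0, z1]] the kernel is compared with the sliding subsolution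
    [kap (exp (A x + A z1 u / s) - exp (A z1))], [0 <= u <= s], which is nonpositive at [u = 0] and at [x = 0];
    large [A] makes it move as fast as needed. *)
Lemma kernel_inf_near_lower_bound z1 c : 0 < z1 -> 0 < c ->
  (forall e N, (forall k, 0 <= e k <= exp (- lam k * s)) -> exp (- lam 0%nat * (s + s)) <= e 0%nat ->
     c <= sum_f_R0 (fun k => e k * pinf k * psi k z1) N) ->
  exists c', 0 < c' /\ forall x l, 0 <= x <= z1 ->
    infinite_sum (fun k => exp (- lam k * (s + s)) * pinf k * psi k x) l -> c' * x <= l.
Proof.
  intros Hz1 Hc Hbd.
  destruct (cont_bounded q z1 ltac:(apply Hd) ltac:(lra)) as [Q [HQ HQ']].
  (* This gives [A^2 / 2 - q A = A (A / 2 - q) >= A z1 / s] on [[0, z1]]: the generator supports the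
     speed of the slide. *)
  set (A := 2 * (z1 / s + Q)).
  assert (Hzs : 0 < z1 / s) by (apply Rdiv_lt_0_compat; lra).
  assert (HA : 0 < A) by (unfold A; lra).
  set (Z := exp (A * z1)).
  assert (HZ : 1 <= Z).
  { unfold Z; rewrite <- exp_0; apply exp_le; assert (0 < A * z1) by (apply Rmult_lt_0_compat; lra); lra. }
  (* At [x = z1] the subsolution is at most [kap Z^2 = c], the lower bound available there. *)
  set (kap := c / (Z * Z)).
  assert (Hkap : 0 < kap) by (apply Rdiv_lt_0_compat; [lra|nra]).
  set (d := fun k => exp (- lam k * s) * pinf k).
  set (K := C / (1 - rho)).
  (* The full kernel at time [s] is nonnegative, so its partial sums are bounded below by minus the
     geometric remainder. *)
  assert (Hstart : forall N x, 0 <= x -> - (K * rho ^ S N) <= esum psi d N x).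
  { intros N x Hx.
    destruct (infinite_sum_geom (fun k => exp (- lam k * s) * pinf k * psi k x) C rho) as [l [Hl Hl']]; auto.
    { intros k; apply kernel_inf_term; auto; lra. }
    specialize (Hl' N); apply Rabs_le_between in Hl'.
    pose proof (kernel_inf_nonneg x l Hx Hl); unfold esum, d; fold K in Hl'; lra. }
  assert (Hmain : forall N x, 0 <= x <= z1 ->
    kap * (Z * (exp (A * x) - 1)) - K * rho ^ S N <= esum psi (fun k => exp (- lam k * s) * d k) N x).
  { intros N x Hx; apply (euler_limit_lower_bound _ _ _ _ _ Hb); auto; intros n.
    set (nn := INR (S n)).
    assert (Hnn : 0 < nn) by (apply lt_0_INR; lia).
    set (h := s / nn).
    assert (Hh : 0 < h) by (apply Rdiv_lt_0_compat; auto).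
    set (y := A * z1 / nn).
    set (del := K * rho ^ S N).
    assert (HZn : exp y ^ S n = Z).
    { rewrite exp_pow; unfold Z; f_equal; fold nn; unfold y; field; lra. }
    assert (Hy1 : 1 <= exp y).
    { rewrite <- exp_0; apply exp_le, Rdiv_le_0_compat; [apply Rmult_le_pos; lra|auto]. }
    assert (HZi : forall i, (i <= S n)%nat -> 1 <= exp y ^ i <= Z).
    { intros i Hi; split; [now apply pow_R1_Rle|rewrite <- HZn; now apply Rle_pow]. }
    assert (Hw : kap * (exp y ^ S n * exp (A * x) - Z) - del <= esum psi (euler_coef lam h (S n) d) N x).
    { apply (euler_comparison gamma lam psi J pinf Hb N d h z1 (S n)
        (fun i x => kap * (exp y ^ i * exp (A * x) - Z) - del)
        (fun i x => kap * exp y ^ i * A * (exp (A * x) * m x))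
        (fun i x => kap * exp y ^ i * (A ^ 2 - 2 * q x * A) * (exp (A * x) * m x))); auto.
      - intros i u Hu; auto_derive; auto.
        pose proof (exp_gamma_mult gamma u) as Hpm.
        replace (p u * (kap * exp y ^ i * A * (exp (A * u) * m u))) with
          (kap * exp y ^ i * A * exp (A * u) * (p u * m u)) by ring.
        rewrite Hpm; ring.
      - intros i u Hu; assert (E := gamma_derive _ _ _ _ Hd u).
        auto_derive; [eexists; eauto|]; derive_subst E; ring.
      - intros i u Hu; pose proof (exp_gamma_mult gamma u) as Hpm.
        replace (h / 2 * p u * (kap * exp y ^ S i * (A ^ 2 - 2 * q u * A) * (exp (A * u) * m u))) with
          (kap * exp (A * u) * (exp y ^ i * (exp y * (h * (A ^ 2 / 2 - q u * A)))) * (p u * m u)) by (simpl; field).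
        rewrite Hpm, Rmult_1_r.
        assert (Hrate : y <= h * (A ^ 2 / 2 - q u * A)).
        { replace y with (h * (A * (z1 / s))) by (unfold h, y; field; lra).
          apply Rmult_le_compat_l; [lra|].
          specialize (HQ' u ltac:(lra)); apply Rabs_le_between in HQ'.
          replace (A ^ 2 / 2 - q u * A) with (A * (A / 2 - q u)) by field.
          apply Rmult_le_compat_l; [lra|unfold A; lra]. }
        (* Discrete subsolution inequality: one step of the slide multiplies by [exp y], and [1 - h
           (A^2 / 2 - q A) <= 1 - y <= exp (- y)] compensates it. *)
        assert (Hshrink : exp y * (1 - h * (A ^ 2 / 2 - q u * A)) <= 1).
        { apply Rle_trans with (exp y * exp (- y)).
          - apply Rmult_le_compat_l; [left; apply exp_pos|].
            pose proof (exp_ineq1_le (- y)); lra.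
          - rewrite <- exp_plus, Rplus_opp_r, exp_0; lra. }
        assert (0 <= kap * exp (A * u) * exp y ^ i).
        { apply Rmult_le_pos; [apply Rmult_le_pos; [lra|left; apply exp_pos]|apply pow_le; left; apply exp_pos]. }
        assert (kap * exp (A * u) * exp y ^ i * (exp y * (1 - h * (A ^ 2 / 2 - q u * A)))
          <= kap * exp (A * u) * exp y ^ i * 1) by (apply Rmult_le_compat_l; auto).
        simpl pow at 1; lra.
      - intros u Hu; apply Rle_trans with (2 := Hstart N u ltac:(lra)); fold del.
        assert (exp (A * u) <= Z) by (apply exp_le, Rmult_le_compat_l; lra).
        simpl; nra.
      - intros i Hi; destruct (HZi i Hi) as [_ HZi2].
        rewrite Rmult_0_r, exp_0, Rmult_1_r.
        assert (0 <= del).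
        { apply Rmult_le_pos; [apply Rdiv_le_0_compat; lra|apply pow_le; lra]. }
        nra.
      - intros i Hi; destruct (HZi i Hi) as [_ HZi2].
        assert (Hd0 : 0 <= del).
        { apply Rmult_le_pos; [apply Rdiv_le_0_compat; lra|apply pow_le; lra]. }
        apply Rle_trans with c.
        + fold Z.
          assert (kap * (exp y ^ i * Z - Z) <= kap * (Z * Z)).
          { apply Rmult_le_compat_l; [lra|].
            assert (exp y ^ i * Z <= Z * Z) by (apply Rmult_le_compat_r; lra); lra. }
          replace (kap * (Z * Z)) with c in H by (unfold kap; field; lra); lra.
        + replace (esum psi (euler_coef lam h i d) N z1) with
            (sum_f_R0 (fun k => (/ (1 + lam k * h)) ^ i * exp (- lam k * s) * pinf k * psi k z1) N)
            by (apply sum_eq; intros; unfold euler_coef, d; ring).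
          (* The Euler factors are at most 1, and for [k = 0] at least [exp (- lam_0 s)] after at
             most [n + 1] steps; hence the two-sided control on [e]. *)
          apply (Hbd (fun k => (/ (1 + lam k * h)) ^ i * exp (- lam k * s))).
          * intros k; destruct (euler_factor_pow _ _ _ _ _ Hb h k i Hh).
            pose proof (exp_pos (- lam k * s)); split; [apply Rmult_le_pos; lra|nra].
          * replace (- lam 0%nat * (s + s)) with (- lam 0%nat * s + - lam 0%nat * s) by ring.
            rewrite exp_plus; apply Rmult_le_compat_r; [left; apply exp_pos|].
            pose proof (Hlam 0%nat) as H0.
            assert (Hlh : 0 < lam 0%nat * h) by (apply Rmult_lt_0_compat; auto).
            replace (- lam 0%nat * s) with (INR (S n) * - (lam 0%nat * h)) by (fold nn; unfold h; field; lra).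
            rewrite <- exp_pow.
            apply Rle_trans with ((/ (1 + lam 0%nat * h)) ^ S n).
            -- apply pow_incr; split; [left; apply exp_pos|].
               rewrite exp_Ropp; apply Rinv_le_contravar; [lra|apply exp_ineq1_le].
            -- replace (S n) with (i + (S n - i))%nat by lia; rewrite pow_add.
               destruct (euler_factor_pow _ _ _ _ _ Hb h 0 i Hh).
               destruct (euler_factor_pow _ _ _ _ _ Hb h 0 (S n - i) Hh).
               nra. }
    rewrite HZn in Hw.
    replace (kap * (Z * (exp (A * x) - 1))) with (kap * (Z * exp (A * x) - Z)) by ring.
    exact Hw. }
  exists (kap * A); split; [apply Rmult_lt_0_compat; lra|].
  intros x l Hx Hl; apply (infinite_sum_ge _ l _ Hl); intros eps Heps.
  destruct (geom_tail_small K rho eps Hrho Heps) as [N0 HN0].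
  exists N0; intros N HN; specialize (HN0 N HN); specialize (Hmain N x Hx).
  replace (sum_f_R0 (fun k => exp (- lam k * (s + s)) * pinf k * psi k x) N) with
    (esum psi (fun k => exp (- lam k * s) * d k) N x).
  2:{ apply sum_eq; intros k _; unfold d.
      replace (- lam k * (s + s)) with (- lam k * s + - lam k * s) by ring; rewrite exp_plus; ring. }
  pose proof (exp_ineq1_le (A * x)).
  assert (0 <= A * x) by (apply Rmult_le_pos; lra).
  assert (A * x <= Z * (exp (A * x) - 1)) by nra.
  assert (kap * (A * x) <= kap * (Z * (exp (A * x) - 1))) by (apply Rmult_le_compat_l; lra).
  lra.
Qed.

(** Far out, half of the first squared term survives and [S <= L]. On [[0, z1]] the bound is linear
    in [x], and [S x <= B x] because [S' = p G] is bounded there. *)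
Lemma kernel_inf_lower_bound : exists c, 0 < c /\ forall x l, 0 <= x ->
  infinite_sum (fun k => exp (- lam k * (s + s)) * pinf k * psi k x) l -> c * Ent x <= l.
Proof.
  set (c := exp (- lam 0%nat * (s + s)) * pinf 0%nat ^ 2 / 2).
  assert (Hp2 : 0 < pinf 0%nat ^ 2) by (apply pow2_gt_0, psi_at_infinity_neq0).
  assert (Hc : 0 < c).
  { apply Rdiv_lt_0_compat; [apply Rmult_lt_0_compat; [apply exp_pos|auto]|lra]. }
  set (K := 2 * C / (1 - rho)).
  assert (HK : 0 <= K) by (apply Rdiv_le_0_compat; lra).
  destruct (entrance_lim _ _ _ _ Hd (c / (K + 1))) as [X [HX HX']].
  { apply Rdiv_lt_0_compat; lra. }
  set (z1 := X + 1).
  assert (Hfar : forall z e N, z1 <= z -> (forall k, 0 <= e k <= exp (- lam k * s)) ->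
    exp (- lam 0%nat * (s + s)) <= e 0%nat -> c <= sum_f_R0 (fun k => e k * pinf k * psi k z) N).
  { intros z e N Hz He He0; unfold z1 in Hz; specialize (HX' z ltac:(lra)).
    pose proof (kernel_inf_far_lower_bound e N z ltac:(lra) He) as H; fold K in H.
    pose proof (entrance_le _ _ _ _ Hd z ltac:(lra)).
    assert (K * (L - Ent z) <= (K + 1) * (c / (K + 1))) by (apply Rmult_le_compat; lra).
    replace ((K + 1) * (c / (K + 1))) with c in H1 by (field; lra).
    assert (2 * c <= e 0%nat * pinf 0%nat ^ 2).
    { unfold c; replace (2 * (exp (- lam 0%nat * (s + s)) * pinf 0%nat ^ 2 / 2)) with
        (exp (- lam 0%nat * (s + s)) * pinf 0%nat ^ 2) by field.
      apply Rmult_le_compat_r; lra. }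
    lra. }
  destruct (kernel_inf_near_lower_bound z1 c ltac:(unfold z1; lra) Hc) as [c' [Hc' Hnear]].
  { intros e N He He0; apply Hfar; auto; lra. }
  destruct (cont_bounded (fun x => p x * G x) z1 ltac:(ctac) ltac:(unfold z1; lra)) as [B [HB HB']].
  pose proof (entrance_limit_nonneg _ _ _ _ Hd) as HL.
  exists (Rmin (c' / B) (c / (L + 1))); split.
  { apply Rmin_pos; apply Rdiv_lt_0_compat; lra. }
  intros x l Hx Hl.
  pose proof (entrance_nonneg _ _ _ _ Hd x Hx) as HE0.
  pose proof (entrance_le _ _ _ _ Hd x Hx) as HE1.
  destruct (Rle_lt_dec x z1) as [Hxz|Hxz].
  - apply Rle_trans with (c' / B * Ent x); [apply Rmult_le_compat_r; [auto|apply Rmin_l]|].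
    apply Rle_trans with (2 := Hnear x l ltac:(lra) Hl).
    assert (HEx : Ent x <= B * x).
    { assert (B * 0 - Ent 0 <= B * x - Ent x); [|rewrite entrance_0 in *; lra].
      apply (derive_nonneg_le (fun y => B * y - Ent y) (fun y => B - p y * G y)); [lra| |]; intros y Hy.
      - evar_last.
        + apply (@is_derive_minus R_AbsRing R_NormedModule); [|apply (entrance_derive _ _ _ _ Hd)].
          apply @is_derive_scal, @is_derive_id.
        + unfold minus, plus, opp, one; simpl; ring.
      - specialize (HB' y ltac:(lra)); apply Rabs_le_between in HB'; lra. }
    replace (c' * x) with (c' / B * (B * x)) by (field; lra).
    apply Rmult_le_compat_l; [left; apply Rdiv_lt_0_compat; lra|auto].
  - apply Rle_trans with (c / (L + 1) * Ent x); [apply Rmult_le_compat_r; [auto|apply Rmin_r]|].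
    apply Rle_trans with (c / (L + 1) * (L + 1)).
    + apply Rmult_le_compat_l; [left; apply Rdiv_lt_0_compat; lra|lra].
    + replace (c / (L + 1) * (L + 1)) with c by (field; lra).
      apply (infinite_sum_ge _ l _ Hl); intros eps Heps; exists 0%nat; intros N _.
      enough (c <= sum_f_R0 (fun k => exp (- lam k * (s + s)) * pinf k * psi k x) N) by lra.
      apply (Hfar x (fun k => exp (- lam k * (s + s)))); [lra| |lra].
      intros k; split; [left; apply exp_pos|apply exp_time_le; lra].
Qed.

End Weights.

End Kernel.

(** * Reduction to globally continuous data *)

Lemma IntR_RInt g a b I : IntR g a b I -> RInt g a b = I.
Proof. intros [pr <-]; apply RInt_Reals. Qed.

Lemma ImproperInt_is_lim g f a l : cont f -> (forall x, a <= x -> g x = f x) ->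
  ImproperInt g a l -> is_lim (fun X => RInt f a X) p_infty l.
Proof.
  intros Hf Hext [Hex Hl]; apply is_lim_spec; intros eps.
  destruct (Hl eps (cond_pos eps)) as [B HB].
  exists (Rmax a B); intros X HX.
  assert (a <= X) by (pose proof (Rmax_l a B); lra).
  assert (B <= X) by (pose proof (Rmax_r a B); lra).
  destruct (Hex X H) as [I HI].
  specialize (HB X I H0 H HI).
  replace (RInt f a X) with I; [exact HB|].
  rewrite <- (IntR_RInt g a X I HI); apply RInt_ext.
  intros x; rewrite Rmin_left, Rmax_right by auto; intros; apply Hext; lra.
Qed.

Lemma cont_clamp f : (forall x, 0 < x -> continuous f x) ->
  (forall eps, 0 < eps -> exists d, 0 < d /\ forall x, 0 <= x < d -> Rabs (f x - f 0) < eps) ->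
  cont (fun x => f (Rmax 0 x)).
Proof.
  intros Hpos H0 x; destruct (Rle_lt_dec x 0) as [Hx|Hx].
  - apply continuity_pt_filterlim; intros eps Heps.
    destruct (H0 eps Heps) as [d [Hd Hd']].
    exists d; split; [exact Hd|]; intros y [_ Hy]; simpl in *; unfold R_dist in *.
    rewrite (Rmax_left 0 x) by lra.
    apply Hd'; split; [apply Rmax_l|].
    apply Rabs_def2 in Hy; apply Rmax_lub_lt; lra.
  - apply (continuous_comp (fun x => Rmax 0 x) f); [apply cont_Rmax0|].
    apply Hpos; rewrite Rmax_right; lra.
Qed.

Lemma Rmax0_id x : 0 <= x -> Rmax 0 x = x.
Proof. apply Rmax_right. Qed.

Lemma derive_zero_eq f a b : a <= b -> (forall x, a < x < b -> is_derive f x 0) ->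
  (forall x, a <= x <= b -> continuous f x) -> f a = f b.
Proof.
  intros Hab Hf Hc; destruct (MVT_gen f a b (fun _ => 0)) as [c [_ H]].
  - intros x; rewrite Rmin_left, Rmax_right by auto; auto.
  - intros x; rewrite Rmin_left, Rmax_right by auto; intros; now apply continuity_pt_filterlim, Hc.
  - lra.
Qed.

Section Normalisation.

Variables (q dq gamma : R -> R).
Hypothesis HC1 : C1_on_nonneg q dq.
Hypothesis Hgamma : gamma_of q gamma.

(** The data are only meaningful on [[0, oo)]; [clamped_psi] and [clamped_flux] integrate the equation from [0] so
    that they are differentiable on the whole line, including at [0], and agree with [psi] on [[0, oo)]. *)
Definition clamped_drift (x : R) : R := q (Rmax 0 x).
Definition clamped_gamma (x : R) : R := RInt (fun y => 2 * clamped_drift y) 0 x.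

Local Notation Q := clamped_drift.
Local Notation gm := clamped_gamma.

Lemma clamped_drift_cont : cont Q.
Proof.
  apply (cont_clamp q).
  - intros x Hx; apply (@ex_derive_continuous R_AbsRing).
    exists (dq x); apply is_derive_Reals, HC1; lra.
  - intros eps Heps.
    assert (Hc : continuity_pt q 0) by (apply derivable_continuous_pt; exists (dq 0); apply HC1; lra).
    destruct (Hc eps Heps) as [d [Hd Hd']]; exists d; split; [exact Hd|]; intros x Hx.
    destruct (Req_dec x 0) as [->|Hne]; [rewrite Rminus_diag, Rabs_R0; exact Heps|].
    apply Hd'; split; [split; [exact I|auto]|].
    simpl; unfold R_dist; rewrite Rminus_0_r, Rabs_pos_eq; lra.
Qed.

Lemma clamped_gamma_derive x : is_derive gm x (2 * Q x).
Proof.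
  apply (is_derive_RInt_cont (fun y => 2 * Q y)), cont_mult; [apply cont_const|apply clamped_drift_cont].
Qed.

Lemma clamped_gamma_cont : cont gm.
Proof. apply cont_derive with (fun x => 2 * Q x), clamped_gamma_derive. Qed.
Hint Resolve clamped_drift_cont clamped_gamma_cont : cont_db.

Lemma clamped_gamma_eq y : 0 <= y -> gamma y = gm y.
Proof.
  intros Hy; rewrite <- (IntR_RInt _ _ _ _ (Hgamma y Hy)); apply RInt_ext.
  intros x; rewrite Rmin_left, Rmax_right by auto; intros Hx.
  unfold clamped_drift; rewrite Rmax0_id by lra; reflexivity.
Qed.

(** (H1) supplies a separate improper integral for each starting point; uniqueness of limits
    identifies them all with [tail gm (G 0)]. *)
Lemma clamped_diffusion : H1 gamma -> (forall M, exists X, forall x, X <= x -> M <= q x) ->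
  exists G0 L, diffusion Q gm G0 L.
Proof.
  intros [G [HG [L HL]]] Hinf.
  set (m := fun x => exp (- gm x)).
  assert (Hm : cont m) by (unfold m; ctac).
  assert (Hlim : forall y, 0 <= y -> is_lim (fun X => RInt m y X) p_infty (G y)).
  { intros y Hy; apply (ImproperInt_is_lim (fun xi => exp (- gamma xi))); auto.
    intros x Hx; unfold m; rewrite clamped_gamma_eq by lra; reflexivity. }
  assert (Htail : forall y, 0 <= y -> G y = tail gm (G 0) y).
  { intros y Hy; unfold tail; fold m.
    assert (H : is_lim (fun X => RInt m 0 y + RInt m y X) p_infty (RInt m 0 y + G y)).
    { apply is_lim_plus'; [apply is_lim_const|auto]. }
    assert (H' : is_lim (fun X => RInt m 0 X) p_infty (RInt m 0 y + G y)).
    { apply is_lim_ext with (2 := H); intros X; now apply RInt_Chasles_cont. }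
    apply is_lim_unique in H'; rewrite (is_lim_unique _ _ _ (Hlim 0 (Rle_refl 0))) in H'.
    injection H' as H'; lra. }
  assert (Htc : cont (tail gm (G 0))).
  { unfold tail; apply cont_minus; [ctac|apply (cont_RInt m), Hm]. }
  assert (Htpos : forall y, 0 <= y -> 0 <= tail gm (G 0) y).
  { intros y Hy; unfold tail.
    enough (RInt m 0 y <= G 0) by (unfold m in *; lra).
    apply (is_lim_infty_ge _ _ _ y (Hlim 0 (Rle_refl 0))); intros X HX.
    apply RInt_nonneg_mono; [lra|auto|]; intros; left; apply exp_pos. }
  assert (Hent : is_lim (entrance gm (G 0)) p_infty L).
  { apply (ImproperInt_is_lim (fun y => exp (gamma y) * G y)); auto; [ctac|].
    intros x Hx; now rewrite clamped_gamma_eq, Htail. }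
  exists (G 0), L; split.
  - apply clamped_drift_cont.
  - apply clamped_gamma_derive.
  - intros M; destruct (Hinf M) as [X HX]; exists (Rmax 0 X); split; [apply Rmax_l|].
    intros x Hx; apply HX.
    pose proof (Rmax_l 0 X); pose proof (Rmax_r 0 X); pose proof (Rmax_r 0 x); lra.
  - exact Htpos.
  - intros eps Heps; assert (H := Hlim 0 (Rle_refl 0)); apply is_lim_spec in H.
    destruct (H (mkposreal eps Heps)) as [X HX]; exists (Rmax 0 (X + 1)); split; [apply Rmax_l|].
    intros x Hx; pose proof (Rmax_r 0 (X + 1)).
    specialize (HX x ltac:(lra)); simpl in HX; apply Rabs_def2 in HX.
    unfold tail; unfold m in HX; lra.
  - intros x Hx; apply (is_lim_infty_ge _ _ _ x Hent); intros X HX.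
    apply RInt_nonneg_mono; [lra|ctac|]; intros y Hy.
    apply Rmult_le_pos; [left; apply exp_pos|auto].
  - intros eps Heps; apply is_lim_spec in Hent.
    destruct (Hent (mkposreal eps Heps)) as [X HX]; exists (Rmax 0 (X + 1)); split; [apply Rmax_l|].
    intros x Hx; pose proof (Rmax_r 0 (X + 1)).
    specialize (HX x ltac:(lra)); simpl in HX; apply Rabs_def2 in HX; lra.
Qed.

Variables (lam : nat -> R) (psi : nat -> R -> R) (psi_inf : nat -> R).
Hypothesis Hbasis : dirichlet_eigenbasis q gamma lam psi psi_inf.

(** Anchored at 1, since the derivative of [psi k] is given only at positive points. *)
Definition clamped_flux (k : nat) (x : R) : R :=
  exp (- gm 1) * Derive (psi k) 1 - 2 * lam k * RInt (fun y => exp (- gm y) * psi k (Rmax 0 y)) 1 x.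

Definition clamped_psi (k : nat) (x : R) : R := RInt (fun y => exp (gm y) * clamped_flux k y) 0 x.

Lemma psi_clamp_cont k : cont (fun x => psi k (Rmax 0 x)).
Proof.
  destruct Hbasis as [_ [_ [Hode [Hzero _]]]].
  apply (cont_clamp (psi k)).
  - intros x Hx; destruct (Hode k) as [d1 [d2 Hd]]; destruct (Hd x Hx) as [H _].
    apply (@ex_derive_continuous R_AbsRing); exists (d1 x); now apply is_derive_Reals.
  - intros eps Heps; destruct (Hzero k) as [H0 H].
    destruct (H eps Heps) as [d [Hd Hd']]; exists d; split; auto.
    intros x Hx; rewrite H0, Rminus_0_r; auto.
Qed.
Hint Resolve psi_clamp_cont : cont_db.

Lemma clamped_flux_derive k x :
  is_derive (clamped_flux k) x (- 2 * lam k * exp (- gm x) * psi k (Rmax 0 x)).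
Proof.
  unfold clamped_flux; evar_last.
  - apply (@is_derive_minus R_AbsRing R_NormedModule); [apply @is_derive_const|].
    apply @is_derive_scal, (is_derive_RInt_cont (fun y => exp (- gm y) * psi k (Rmax 0 y))).
    apply (cont_mult (fun y => exp (- gm y)) (fun y => psi k (Rmax 0 y))); [ctac|apply psi_clamp_cont].
  - unfold minus, plus, opp, zero; simpl; ring.
Qed.

Lemma clamped_flux_cont k : cont (clamped_flux k).
Proof. exact (cont_derive _ _ (clamped_flux_derive k)). Qed.
Hint Resolve clamped_flux_cont : cont_db.

Lemma clamped_psi_derive k x : is_derive (clamped_psi k) x (exp (gm x) * clamped_flux k x).
Proof. apply (is_derive_RInt_cont (fun y => exp (gm y) * clamped_flux k y)); ctac. Qed.

(** On the open half-line [exp (- gm) psi'] and the clamped flux have equal derivatives and agree at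
    1. Hence both functions have the same derivative there, and continuity at 0, where both vanish,
    concludes. *)
Lemma clamped_psi_eq k x : 0 <= x -> clamped_psi k x = psi k x.
Proof.
  intros Hx; destruct Hbasis as [_ [_ [Hode [Hzero _]]]].
  destruct (Hode k) as [d1 [d2 Hd]].
  assert (Hflux : forall y, 0 < y -> is_derive (fun y => exp (- gm y) * d1 y - clamped_flux k y) y 0).
  { intros y Hy; destruct (Hd y Hy) as [_ [H2 Heq]]; apply is_derive_Reals in H2.
    assert (E1 := clamped_flux_derive k y); assert (E2 := clamped_gamma_derive y).
    rewrite Rmax0_id in E1 by lra.
    assert (HQ : Q y = q y) by (unfold clamped_drift; rewrite Rmax0_id; auto; lra).
    rewrite HQ in E2.
    auto_derive; [repeat split; eexists; eauto|].
    derive_subst E1; derive_subst E2; derive_subst H2.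
    replace (d2 y) with (2 * q y * d1 y - 2 * lam k * psi k y) by lra; ring. }
  assert (H1 : exp (- gm 1) * d1 1 - clamped_flux k 1 = 0).
  { unfold clamped_flux; rewrite RInt_point0.
    replace (Derive (psi k) 1) with (d1 1); [ring|].
    symmetry; apply is_derive_unique, is_derive_Reals, Hd; lra. }
  assert (Heq : forall y, 0 < y -> clamped_flux k y = exp (- gm y) * d1 y).
  { intros y Hy.
    assert (Hc : forall z, 0 < z -> continuous (fun y => exp (- gm y) * d1 y - clamped_flux k y) z).
    { intros z Hz; apply (@ex_derive_continuous R_AbsRing); exists 0; now apply Hflux. }
    destruct (Rle_lt_dec 1 y) as [Hy1|Hy1].
    - assert (H := derive_zero_eq (fun y => exp (- gm y) * d1 y - clamped_flux k y) 1 y Hy1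
        ltac:(intros; apply Hflux; lra) ltac:(intros; apply Hc; lra)); cbv beta in H; lra.
    - assert (H := derive_zero_eq (fun y => exp (- gm y) * d1 y - clamped_flux k y) y 1 ltac:(lra)
        ltac:(intros; apply Hflux; lra) ltac:(intros; apply Hc; lra)); cbv beta in H; lra. }
  assert (H := derive_zero_eq (fun y => clamped_psi k y - psi k (Rmax 0 y)) 0 x Hx).
  cbv beta in H; rewrite (Rmax0_id 0), (Rmax0_id x), (proj1 (Hzero k)) in H by lra.
  assert (Hz0 : clamped_psi k 0 = 0) by apply RInt_point0.
  rewrite Hz0 in H.
  enough (0 - 0 = clamped_psi k x - psi k x) by lra.
  apply H.
  - intros y Hy; evar_last.
    + apply (@is_derive_minus R_AbsRing R_NormedModule); [apply clamped_psi_derive|].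
      apply is_derive_ext_loc with (psi k); [|apply is_derive_Reals, Hd; lra].
      exists (mkposreal y (proj1 Hy)); intros z Hz.
      apply Rabs_def2 in Hz; simpl in Hz; unfold minus, plus, opp in Hz; simpl in Hz.
      rewrite Rmax0_id; auto; lra.
    + rewrite Heq by lra.
      rewrite <- Rmult_assoc, exp_gamma_mult, Rmult_1_l; apply Rminus_diag.
  - intros y _; apply @continuous_minus; [|apply psi_clamp_cont].
    apply (@ex_derive_continuous R_AbsRing); eexists; apply clamped_psi_derive.
Qed.

Lemma clamped_eigenbasis : eigenbasis gm lam clamped_psi clamped_flux psi_inf.
Proof.
  assert (Hc : forall k, cont (clamped_psi k)).
  { intros k; exact (cont_derive _ _ (clamped_psi_derive k)). }
  assert (Hbasis' := Hbasis).
  destruct Hbasis' as [Hl0 [Hincr [_ [_ [Hbd [Hlim [Horth Hcomp]]]]]]].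
  split.
  - intros k; split; auto.
    + assert (H : lam 0%nat <= lam k); [|lra].
      induction k as [|k IH]; [lra|specialize (Hincr k); lra].
    + apply clamped_flux_cont.
    + apply clamped_psi_derive.
    + intros x Hx; rewrite clamped_psi_eq by auto.
      assert (H := clamped_flux_derive k x); rewrite Rmax0_id in H by auto; exact H.
    + apply RInt_point0.
    + destruct (Hbd k) as [M HM]; exists M; intros x Hx; rewrite clamped_psi_eq; auto.
  - exact Hincr.
  - intros k; apply is_lim_spec; intros eps.
    destruct (Hlim k eps (cond_pos eps)) as [X HX].
    exists (Rmax 0 X); intros x Hx; pose proof (Rmax_l 0 X); pose proof (Rmax_r 0 X).
    rewrite clamped_psi_eq by lra; apply HX; lra.
  - intros j k.
    apply (ImproperInt_is_lim (fun x => psi j x * psi k x * mu_density gamma x)).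
    + pose proof (Hc j); pose proof (Hc k); ctac.
    + intros x Hx; unfold mu_density.
      now rewrite !clamped_psi_eq, clamped_gamma_eq.
    + apply Horth.
  - intros f a b Ha Hab Hf Hsupp.
    destruct (Hcomp f a b Ha Hab) as [c [nf [Hck [Hnf Hsum]]]]; auto.
    { intros x; apply continuity_pt_filterlim, Hf. }
    exists nf; split.
    + rewrite <- (IntR_RInt _ _ _ _ Hnf); apply RInt_ext.
      intros x; rewrite Rmin_left, Rmax_right by lra; intros Hx.
      unfold mu_density; rewrite (clamped_gamma_eq x) by lra; reflexivity.
    + assert (Hc' : forall k, c k = RInt (fun x => f x * clamped_psi k x * (2 * exp (- gm x))) a b).
      { intros k; rewrite <- (IntR_RInt _ _ _ _ (Hck k)); apply RInt_ext.
        intros x; rewrite Rmin_left, Rmax_right by lra; intros Hx.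
        unfold mu_density; rewrite (clamped_gamma_eq x), clamped_psi_eq by lra; reflexivity. }
      intros eps Heps; destruct (Hsum eps Heps) as [N HN]; exists N; intros n Hn.
      rewrite <- (sum_eq (fun k => c k ^ 2)); [auto|intros; now rewrite Hc'].
Qed.

End Normalisation.

(** * Assembly: summation of the series and the ratio estimate *)

Lemma entrance_pos q gamma G0 L x : diffusion q gamma G0 L -> 0 < x -> 0 < entrance gamma G0 x.
Proof.
  intros Hd Hx.
  assert (Hg := gamma_cont _ _ _ _ Hd); assert (HG := tail_cont _ _ _ _ Hd).
  assert (Hm : cont (fun z => exp (- gamma z))) by (apply cont_exp, cont_opp, Hg).
  apply RInt_gt_0; auto.
  - intros y Hy; apply Rmult_lt_0_compat; [apply exp_pos|].
    pose proof (tail_nonneg _ _ _ _ Hd (y + 1) ltac:(lra)) as H; unfold tail in *.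
    rewrite <- (RInt_Chasles_cont (fun z => exp (- gamma z)) 0 y (y + 1)) in H by auto.
    assert (0 < RInt (fun z => exp (- gamma z)) y (y + 1)); [|lra].
    apply RInt_gt_0; [lra|intros; apply exp_pos|intros; apply Hm].
  - intros y _; apply (cont_mult (fun y => exp (gamma y)) (tail gamma G0)); auto.
    apply cont_exp, Hg.
Qed.

Lemma infinite_sum_ext u v l : (forall k, u k = v k) -> infinite_sum u l -> infinite_sum v l.
Proof.
  intros Huv H eps Heps; destruct (H eps Heps) as [N HN]; exists N; intros n Hn.
  rewrite <- (sum_eq u); auto.
Qed.

(** [series_sum] is a choice and has meaning only once convergence is known. The sequence [u] is
    written with the extended eigenfunctions, [v] with the original ones. *)
Lemma series_sum_geom u v C rho : 0 <= rho < 1 -> 0 <= C -> (forall k, u k = v k) ->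
  (forall k, Rabs (u k) <= C * rho ^ k) -> infinite_sum u (series_sum v).
Proof.
  intros Hr HC Huv Hu; destruct (infinite_sum_geom u C rho Hr HC Hu) as [l [Hl _]].
  apply infinite_sum_ext with v; [auto|].
  apply (epsilon_spec (inhabits 0) (fun l => infinite_sum v l)).
  exists l; now apply infinite_sum_ext with u.
Qed.

Theorem theorem1p8 (q dq gamma : R -> R) (lam : nat -> R)
    (psi : nat -> R -> R) (psi_inf : nat -> R) :
  C1_on_nonneg q dq -> gamma_of q gamma ->
  H1 gamma -> H2 q dq -> H3 q ->
  dirichlet_eigenbasis q gamma lam psi psi_inf ->
  forall t, 0 < t ->
  forall eps, 0 < eps -> exists Z, forall z, Z <= z -> forall x, 0 < x ->
    Rabs (r_inf lam psi psi_inf t x / r_fin lam psi t z x - 1) <= eps.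
Proof.
  intros HC1 Hgamma HH1 [Hinf Hratio] [a [x0 [Ha [Hx0 Halmost]]]] Hbasis t Ht eps Heps.
  destruct (clamped_diffusion q dq gamma HC1 Hgamma HH1 Hinf) as [G0 [L Hd]].
  assert (Hb := clamped_eigenbasis q dq gamma HC1 Hgamma lam psi psi_inf Hbasis).
  set (Q := clamped_drift q) in *; set (gm := clamped_gamma q) in *.
  set (ps := clamped_psi q lam psi) in *; set (J := clamped_flux q lam psi) in *.
  assert (Hps : forall k x, 0 <= x -> ps k x = psi k x).
  { intros k x Hx; exact (clamped_psi_eq q dq gamma HC1 lam psi psi_inf Hbasis k x Hx). }
  assert (HQ : forall x, 0 <= x -> Q x = q x).
  { intros x Hx; unfold Q, clamped_drift; now rewrite Rmax0_id. }
  assert (Hdq : exists X, 0 <= X /\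
    forall x, X <= x -> is_derive Q x (dq x) /\ Rabs (dq x) <= / 2 * Q x ^ 2).
  { destruct (Hratio (/ 2) ltac:(lra)) as [X1 HX1]; destruct (Hinf 1) as [X2 HX2].
    exists (Rmax 1 (Rmax X1 X2)); split; [apply Rle_trans with (2 := Rmax_l _ _); lra|].
    intros x Hx.
    assert (Hx1 : 1 <= x) by (apply Rle_trans with (2 := Hx), Rmax_l).
    assert (HxX1 : X1 <= x) by (apply Rle_trans with (2 := Hx); eapply Rle_trans; [apply Rmax_l|apply Rmax_r]).
    assert (HxX2 : X2 <= x) by (apply Rle_trans with (2 := Hx); eapply Rle_trans; [apply Rmax_r|apply Rmax_r]).
    split.
    - apply is_derive_ext_loc with q; [|apply is_derive_Reals, HC1; lra].
      exists posreal_one; intros z Hz; apply Rabs_def2 in Hz; simpl in Hz.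
      unfold minus, plus, opp in Hz; simpl in Hz.
      symmetry; apply HQ; lra.
    - rewrite HQ by lra; specialize (HX1 x HxX1); specialize (HX2 x HxX2).
      assert (Hq2 : 0 < q x ^ 2) by (apply pow_lt; lra).
      unfold Rdiv in HX1; rewrite Rabs_mult, Rabs_inv, (Rabs_pos_eq (q x ^ 2)) in HX1 by lra.
      apply (Rmult_lt_compat_r (q x ^ 2)) in HX1; [|auto].
      rewrite Rmult_assoc, Rinv_l, Rmult_1_r in HX1; lra. }
  assert (HalmostQ : forall x y, x0 <= x -> x <= y -> a * Q x <= Q y).
  { intros x y Hx Hxy; rewrite !HQ by lra; auto. }
  assert (Hsup : forall tau, 0 < tau -> exists C, 0 < C /\
    forall k x, 0 <= x -> ps k x ^ 2 <= C * exp (tau * lam k)).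
  { intros tau Htau.
    destruct (eigenfn_sup_bound Q gm dq G0 L a x0 Hd Hdq Ha HalmostQ tau Htau) as [C [HC HC']].
    exists C; split; auto; intros k.
    apply (HC' (lam k) (ps k) (J k)); [apply Hb|].
    intros x Hx; exact (psi_le_scale _ _ _ _ _ _ _ _ Hd Hb k x Hx). }
  (* The lower bound is proved at time [s + s], the summability weights at time [s]. *)
  set (s := t / 2).
  destruct (eigen_weights Q gm G0 L lam ps J psi_inf Hd Hb s Hsup ltac:(unfold s; lra))
    as [M [C [rho [HC [Hrho [HM HW]]]]]].
  destruct (kernel_inf_lower_bound Q gm G0 L lam ps J psi_inf Hd Hb M C rho s HC Hrho
    ltac:(unfold s; lra) HM HW) as [c [Hc Hlow]].
  replace (s + s) with t in Hlow by (unfold s; field).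
  set (K := 4 * C / (1 - rho)).
  assert (HK : 0 <= K) by (apply Rdiv_le_0_compat; lra).
  (* The first entry of the minimum keeps [r_fin] above [c / 2 * S x], so that division is possible;
     the second makes the difference at most [eps] times this bound. *)
  set (del := Rmin (c / 2) (eps * (c / 2)) / (K + 1)).
  assert (Hdel : 0 < del).
  { apply Rdiv_lt_0_compat; [apply Rmin_pos; [lra|apply Rmult_lt_0_compat; lra]|lra]. }
  destruct (entrance_lim _ _ _ _ Hd del Hdel) as [Z [HZ HZ']].
  exists Z; intros z Hz x Hx; specialize (HZ' z Hz).
  pose proof (entrance_pos _ _ _ _ x Hd Hx) as HE.
  pose proof (entrance_le _ _ _ _ Hd z ltac:(lra)) as HEz.
  assert (Hinfsum : infinite_sum (fun k => exp (- lam k * t) * psi_inf k * ps k x) (r_inf lam psi psi_inf t x)).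
  { apply (series_sum_geom _ _ C rho Hrho HC).
    - intros k; rewrite Hps by lra; reflexivity.
    - intros k; apply (kernel_inf_term gm lam ps J psi_inf Hb M C rho s HM HW); unfold s; lra. }
  assert (Hfinsum : infinite_sum (fun k => exp (- lam k * t) * ps k z * ps k x) (r_fin lam psi t z x)).
  { apply (series_sum_geom _ _ C rho Hrho HC).
    - intros k; rewrite !Hps by lra; reflexivity.
    - intros k; apply (kernel_fin_term gm lam ps J psi_inf Hb M C rho s HM HW); unfold s; lra. }
  pose proof (kernel_difference Q gm G0 L lam ps J psi_inf Hd Hb M C rho s HC Hrho HM HW t z x _ _
    ltac:(unfold s; lra) ltac:(lra) ltac:(lra) Hinfsum Hfinsum) as Hdiff; fold K in Hdiff.
  specialize (Hlow x _ ltac:(lra) Hinfsum).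
  set (E := entrance gm G0 x) in *; set (D := L - entrance gm G0 z) in *.
  set (ri := r_inf lam psi psi_inf t x) in *; set (rf := r_fin lam psi t z x) in *.
  assert (HKD : K * D <= Rmin (c / 2) (eps * (c / 2))).
  { replace (Rmin (c / 2) (eps * (c / 2))) with ((K + 1) * del) by (unfold del; field; lra).
    apply Rmult_le_compat; unfold D in *; lra. }
  pose proof (Rmin_l (c / 2) (eps * (c / 2))); pose proof (Rmin_r (c / 2) (eps * (c / 2))).
  assert (HKDE1 : K * (E * D) <= c / 2 * E) by (replace (K * (E * D)) with (K * D * E) by ring; apply Rmult_le_compat_r; lra).
  assert (HKDE2 : K * (E * D) <= eps * (c / 2) * E) by (replace (K * (E * D)) with (K * D * E) by ring; apply Rmult_le_compat_r; lra).
  assert (HcE : 0 < c / 2 * E) by (apply Rmult_lt_0_compat; lra).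
  assert (Hrf : c / 2 * E <= rf) by (apply Rabs_le_between in Hdiff; lra).
  replace (ri / rf - 1) with ((ri - rf) / rf) by (field; lra).
  unfold Rdiv; rewrite Rabs_mult, Rabs_inv, (Rabs_pos_eq rf) by lra.
  apply (Rmult_le_reg_r rf); [lra|].
  rewrite Rmult_assoc, Rinv_l, Rmult_1_r by lra.
  apply Rle_trans with (1 := Hdiff); apply Rle_trans with (1 := HKDE2).
  rewrite Rmult_assoc; apply Rmult_le_compat_l; lra.
Qed.
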